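(* Let $\alpha\in(-\infty,0]$. For every $f\in\mathcal{C}_\alpha(\mathbb{R}^n)$ there is a sequence of Minkowski symmetrizations of $f$ which hypo-converges to its reflectional hypo-symmetrization $f_{\rm sym}^{(\alpha)}\in\mathcal{C}_\alpha(\mathbb{R}^n)$; that is, there is a sequence $u_1,u_2,\ldots\in\mathbb{S}^{n-1}$ such that $\tau_{u_k}^\alpha\circ\cdots\circ\tau_{u_1}^\alpha f$ hypo-converges to $f_{\rm sym}^{(\alpha)}$ as $k\to\infty$.
   Context: For $\alpha\in(-\infty,0]$, a function $f:\mathbb{R}^n\to[0,\infty)$ is $\alpha$-concave if $\{f>0\}$ is convex and for all $x,y$ with $f(x),f(y)>0$ and $\lambda\in[0,1]$, $f(\lambda x+(1-\lambda)y)$ is at least $(\lambda f(x)^\alpha+(1-\lambda)f(y)^\alpha)^{1/\alpha}$ if $\alpha<0$, and at least $f(x)^\lambda f(y)^{1-\lambda}$ if $\alpha=0$. $\mathcal{C}_\alpha(\mathbb{R}^n)$ is the set of $\alpha$-concave, upper semicontinuous $f:\mathbb{R}^n\to[0,\infty)$, not identically zero, with $\lim_{|x|\to\infty}f(x)=0$. For $u\in\mathbb{S}^{n-1}$, $R_u(x)=x-2\langle x,u\rangle u$. The $\alpha$-Minkowski symmetral of $f\in\mathcal{C}_\alpha(\mathbb{R}^n)$ is $$\tau_u^\alpha f(x)=\sup_{y+z=x}\left(\tfrac12 f(2y)^\alpha+\tfrac12 f(R_u(2z))^\alpha\right)^{1/\alpha}\ (\alpha<0),\qquad \tau_u^0 f(x)=\sup_{y+z=x}\sqrt{f(2y)f(R_u(2z))},$$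 where for $\alpha<0$ the expression in the supremum is $0$ if one of the two values of $f$ is $0$. It again belongs to $\mathcal{C}_\alpha(\mathbb{R}^n)$. Base function: $\psi=\mathrm{base}_\alpha f:=(1-f^\alpha)/\alpha$ for $\alpha<0$ and $\mathrm{base}_0 f:=-\log f$, with value $+\infty$ where $f=0$. Then $\psi\in\mathrm{Conv}_{\rm c}(\mathbb{R}^n)$, the set of convex, lower semicontinuous, proper, coercive functions $\mathbb{R}^n\to(-\infty,+\infty]$. Let $\mathcal{L}\psi(x)=\sup_y(\langle x,y\rangle-\psi(y))$. The function $\psi_{\rm sym}$ is the unique radial (i.e. $\mathrm{O}(n)$-invariant) function in $\mathrm{Conv}_{\rm c}(\mathbb{R}^n)$ with $\mathcal{L}\psi_{\rm sym}(x)=\int_{\mathrm{O}(n)}\mathcal{L}\psi(\vartheta^{-1}x)\,d\eta(\vartheta)$ for all $x$, where $\eta$ is the Haar probability measure on $\mathrm{O}(n)$. The reflectional hypo-symmetrization of $f$ is $f_{\rm sym}^{(\alpha)}:=(1-\alpha\psi_{\rm sym})^{1/\alpha}$ for $\alpha<0$ and $f_{\rm sym}^{(0)}:=e^{-\psi_{\rm sym}}$ for $\alpha=0$ (value $0$ where $\psi_{\rm sym}=+\infty$). A sequence $f_k$ hypo-converges to $f$ if for every $x$: $\limsup_k f_k(x_k)\le f(x)$ for every sequence $x_k\to x$, and $f_k(x_k)\to f(x)$ for at least one sequence $x_k\to x$. *)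

(* Defs.v *)
From HB Require Import structures.
From mathcomp Require Import all_boot all_order all_algebra.
From mathcomp Require Import all_classical all_reals all_analysis.

Set Implicit Arguments.
Unset Strict Implicit.
Unset Printing Implicit Defensive.

Import Order.TTheory GRing.Theory Num.Theory.
Import numFieldNormedType.Exports.

Local Open Scope classical_set_scope.
Local Open Scope ring_scope.

Section Euclidean.
Context {R : realType} {n : nat}.

Definition inner (x y : 'cV[R]_n) : R := \sum_(i < n) x i 0 * y i 0.

(* The library norm on matrices is the sup norm, hence this separate one. *)
Definition enorm (x : 'cV[R]_n) : R := Num.sqrt (inner x x).

Definition usphere : set 'cV[R]_n := [set u | enorm u = 1].

(* The filter |x| -> oo on R^n. *)
Definition at_infty : set_system 'cV[R]_n :=
  filter_from [set: R] (fun r => [set x | r < enorm x]).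

Definition reflection (u x : 'cV[R]_n) : 'cV[R]_n := x - (2 * inner x u) *: u.

Definition orthogonal_group : set 'M[R]_n := [set A | A *m A^T = 1%:M].

Definition radial (T : Type) (g : 'cV[R]_n -> T) : Prop :=
  forall A, orthogonal_group A -> forall x, g (A *m x) = g x.

End Euclidean.

(* Square matrices with their Borel sigma-algebra. *)
Definition borel_mx (R : realType) (n : nat) :=
  g_sigma_algebraType (@open 'M[R]_n).

(* The Haar probability measure of O(n), as a Borel probability measure on the
   space of matrices that is carried by O(n). *)
Definition is_haar (R : realType) (n : nat)
    (eta : probability (borel_mx R n) R) : Prop :=
  eta (@orthogonal_group R n) = 1%E /\
  forall A : 'M[R]_n, orthogonal_group A ->
  forall B : set (borel_mx R n), measurable B ->
    eta [set theta : 'M[R]_n | B (A *m theta)] = eta B.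

Section AlphaConcave.
Context {R : realType} {n : nat}.
Implicit Types (alpha : R) (f g : 'cV[R]_n -> R).

Definition upper_semicontinuous f : Prop :=
  forall (x : 'cV[R]_n) a, f x < a -> \forall y \near x, f y < a.

Definition alpha_concave alpha f : Prop :=
  @convex_set R 'cV[R]_n [set x | 0 < f x] /\
  forall (x y : 'cV[R]_n) (l : R), 0 < f x -> 0 < f y -> 0 <= l <= 1 ->
    (if alpha == 0 then f x `^ l * f y `^ (1 - l)
     else (l * f x `^ alpha + (1 - l) * f y `^ alpha) `^ alpha^-1)
    <= f (l *: x + (1 - l) *: y).

Definition C_alpha alpha f : Prop :=
  [/\ forall x, 0 <= f x,
      alpha_concave alpha f,
      upper_semicontinuous f,
      exists x, f x != 0
    & f @ at_infty --> (0 : R)].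

Definition symmetral alpha (u : 'cV[R]_n) f (x : 'cV[R]_n) : R :=
  let term y z :=
    let a := f (2 *: y) in
    let b := f (reflection u (2 *: z)) in
    if alpha == 0 then Num.sqrt (a * b)
    else if (a == 0) || (b == 0) then 0
    else (2^-1 * a `^ alpha + 2^-1 * b `^ alpha) `^ alpha^-1 in
  sup [set t | exists y z, y + z = x /\ t = term y z].

(* Sequences are indexed from 0: the first direction used is [u 0]. *)
Fixpoint symmetrals alpha (u : nat -> 'cV[R]_n) f (k : nat) : 'cV[R]_n -> R :=
  if k is j.+1 then symmetral alpha (u j) (symmetrals alpha u f j) else f.

Definition hypo_cvg (fs : nat -> 'cV[R]_n -> R) f : Prop :=
  forall x : 'cV[R]_n,
    (forall xs : nat -> 'cV[R]_n, xs @ \oo --> x ->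
       (limn_esup (fun k => (fs k (xs k))%:E) <= (f x)%:E)%E) /\
    (exists2 xs : nat -> 'cV[R]_n, xs @ \oo --> x &
       fs k (xs k) @[k --> \oo] --> f x).

End AlphaConcave.

Section BaseFunction.
Context {R : realType} {n : nat}.
Implicit Types (alpha : R) (f : 'cV[R]_n -> R) (psi : 'cV[R]_n -> \bar R).
Local Open Scope ereal_scope.

(* Convex, lower semicontinuous, proper, coercive functions with values in
   (-oo, +oo]. *)
Definition Conv_c psi : Prop :=
  [/\ forall x, psi x != -oo,
      forall (x y : 'cV[R]_n) (l : R), (0 <= l <= 1)%R ->
        psi (l *: x + (1 - l) *: y)%R <= l%:E * psi x + (1 - l)%:E * psi y,
      lower_semicontinuous psi,
      exists x, psi x != +oo
    & psi @ at_infty --> +oo].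

Definition legendre psi (x : 'cV[R]_n) : \bar R :=
  ereal_sup [set (inner x y)%:E - psi y | y in [set: 'cV[R]_n]].

Definition base alpha f (x : 'cV[R]_n) : \bar R :=
  if f x == 0%R then +oo
  else if alpha == 0%R then (- ln (f x))%:E
  else ((1 - f x `^ alpha) / alpha)%:E.

Definition is_psi_sym (eta : probability (borel_mx R n) R) psi
    (phi : 'cV[R]_n -> \bar R) : Prop :=
  [/\ Conv_c phi, radial phi
    & forall x, legendre phi x =
        \int[eta]_(theta in @orthogonal_group R n)
          legendre psi (invmx theta *m x)].

(* For psi in Conv_c there is exactly one phi with [is_psi_sym eta psi phi];
   the default value of [xget] is irrelevant. *)
Definition psi_sym (eta : probability (borel_mx R n) R) psi :
    'cV[R]_n -> \bar R :=
  xget (fun=> +oo) [set phi | is_psi_sym eta psi phi].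

(* Inverse of [base alpha]. *)
Definition unbase alpha psi (x : 'cV[R]_n) : R :=
  if psi x == +oo then 0%R
  else if alpha == 0%R then expR (- fine (psi x))
  else ((1 - alpha * fine (psi x)) `^ alpha^-1)%R.

Definition reflectional_hyposym (eta : probability (borel_mx R n) R) alpha f :
    'cV[R]_n -> R :=
  unbase alpha (psi_sym eta (base alpha f)).

End BaseFunction.

(* Main.v *)
Require Import Defs.
From mathcomp Require Import all_boot all_order all_algebra.
From mathcomp Require Import all_classical all_reals all_analysis.
From mathcomp Require Import measurable_realfun ring lra.

(** Passing to base functions turns the alpha-Minkowski symmetral along [u] into
    the infimal average [(psi, u) |-> inf_(p + R_u q = 2x) (psi p + psi q) / 2],
    and the Legendre transform turns this into the reflection average
    [w |-> (w + w o R_u) / 2].  The finite parts of [L psi] are captured by the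
    Lipschitz functions [w_N y = sup_(|x| <= |x0| + N) (<y, x> - psi x)].

    On a sphere, finitely many reflections carry the points of a net to a given
    point, so a bounded number of reflection averages decreases the oscillation
    of a Lipschitz function by a fixed amount.  Oscillations never increase
    again, so one sequence of reflections makes all [w_N] converge, on all
    spheres of rational radius and hence locally uniformly, to functions that are
    constant on spheres.  The Haar mean of [w_N] is invariant under reflection
    averages, so these limits are the Haar means of the [w_N], whose supremum
    is [Lambda = L psi_sym] by monotone convergence.

    Hypo-convergence then follows by duality.  The upper bound is the inequality
    [psi_k x >= <x, y> - L psi_k y] with [y] such that [L psi = w_N] on the
    sphere through [y]; such [y] are dense enough in the domain of [Lambda].
    Recovery sequences are the proximal points of the [psi_k], whose
    subgradients tie [psi_k] to the values of [L psi_k >= w_N,k].  The same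
    proximal points prove the Fenchel-Moreau theorem. *)

Set Implicit Arguments.
Unset Strict Implicit.
Unset Printing Implicit Defensive.

Import Order.TTheory GRing.Theory Num.Theory.
Import numFieldNormedType.Exports.

Local Open Scope classical_set_scope.
Local Open Scope ring_scope.

(** * Euclidean space, reflections and orthogonal matrices *)

Section EuclideanSpace.
Context {R : realType} {n : nat}.
Implicit Types (x y z u v p q : 'cV[R]_n) (a b c s t e : R).

(** The obstacle is that [L psi] may take the value [+oo], so that no oscillation estimate applies
    to it directly. The truncations are finite and Lipschitz, but they control [L psi_k] only from
    below. An upper bound on [L psi_k y] requires a sphere on which a single truncation already
    equals [L psi]. Finiteness of [Lambda y] forces this on every strictly smaller sphere: otherwise
    [L psi] would be arbitrarily large near some direction, and finitely many reflections would
    spread these values over the whole sphere through [y]. Replacing [y] by [(1 - tau) y] costs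
    little, as [Lambda] is convex and bounded above at the origin.

    Uniformity in [k] rests on quantities that infimal averages preserve with the same constants:
    the growth [a |x| + b] and a point of value at most [v0] in a fixed ball. They confine the
    proximal points, hence their subgradients, to balls independent of [k], where locally uniform
    convergence of the averaged truncations applies. *)

Lemma innerC x y : inner x y = inner y x.
Proof. by apply: eq_bigr => i _; rewrite mulrC. Qed.

Lemma innerDl x y z : inner (x + y) z = inner x z + inner y z.
Proof.
by rewrite /inner -big_split; apply: eq_bigr => i _; rewrite mxE mulrDl.
Qed.

Lemma innerZl a x y : inner (a *: x) y = a * inner x y.
Proof.
by rewrite /inner mulr_sumr; apply: eq_bigr => i _; rewrite mxE mulrA.
Qed.

Lemma innerNl x y : inner (- x) y = - inner x y.
Proof. by rewrite -scaleN1r innerZl mulN1r. Qed.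

Lemma innerDr x y z : inner x (y + z) = inner x y + inner x z.
Proof. by rewrite innerC innerDl !(innerC x). Qed.

Lemma innerZr a x y : inner x (a *: y) = a * inner x y.
Proof. by rewrite innerC innerZl innerC. Qed.

Lemma innerNr x y : inner x (- y) = - inner x y.
Proof. by rewrite innerC innerNl innerC. Qed.

Lemma inner0l x : inner 0 x = 0.
Proof. by rewrite -(scale0r 0) innerZl mul0r. Qed.

Lemma inner0r x : inner x 0 = 0.
Proof. by rewrite innerC inner0l. Qed.

Definition innerE := (innerDl, innerDr, innerNl, innerNr, innerZl, innerZr).

Lemma inner_ge0 x : 0 <= inner x x.
Proof. by apply: sumr_ge0 => i _; rewrite -expr2 sqr_ge0. Qed.

Lemma sqr_enorm x : enorm x ^+ 2 = inner x x.
Proof. by rewrite sqr_sqrtr // inner_ge0. Qed.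

Lemma enorm_ge0 x : 0 <= enorm x.
Proof. exact: sqrtr_ge0. Qed.
Hint Resolve enorm_ge0 : core.

Lemma enorm_eqP x y : inner x x = inner y y -> enorm x = enorm y.
Proof. by rewrite /enorm => ->. Qed.

Lemma enormZ a x : enorm (a *: x) = `|a| * enorm x.
Proof.
by rewrite /enorm innerZl innerZr mulrA -expr2 sqrtrM ?sqr_ge0// sqrtr_sqr.
Qed.

Lemma enormN x : enorm (- x) = enorm x.
Proof. by rewrite -scaleN1r enormZ normrN1 mul1r. Qed.

Lemma enormB x y : enorm (x - y) = enorm (y - x).
Proof. by rewrite -enormN opprB. Qed.

Lemma enorm0 : enorm (0 : 'cV[R]_n) = 0.
Proof. by rewrite /enorm inner0l sqrtr0. Qed.

Lemma inner_eq0 x : inner x x = 0 -> x = 0.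
Proof.
move=> /eqP; rewrite psumr_eq0; last by move=> i _; rewrite -expr2 sqr_ge0.
move=> /allP h; apply/colP => i; rewrite mxE.
have := h i; rewrite mem_index_enum => /(_ isT); rewrite -expr2 sqrf_eq0.
by move/eqP.
Qed.

Lemma enorm_eq0 x : enorm x = 0 -> x = 0.
Proof. by move=> x0; apply: inner_eq0; rewrite -sqr_enorm x0 expr0n. Qed.

Lemma cauchy_schwarz x y : inner x y <= enorm x * enorm y.
Proof.
have := inner_ge0 (enorm y *: x - enorm x *: y).
rewrite !innerE (innerC y x) -!sqr_enorm.
have [x0|x0] := eqVneq (enorm x) 0.
  by rewrite (enorm_eq0 x0) inner0l enorm0 !mul0r.
have [y0|y0] := eqVneq (enorm y) 0.
  by rewrite (enorm_eq0 y0) inner0r enorm0 !mulr0.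
have xy : 0 < enorm x * enorm y by rewrite mulr_gt0// lt0r ?x0 ?y0/=.
move=> h; rewrite -(ler_pM2l xy); move: h.
set a := enorm x; set b := enorm y; nra.
Qed.

Lemma enormD x y : enorm (x + y) <= enorm x + enorm y.
Proof.
rewrite -(@ler_pXn2r _ 2) ?nnegrE ?addr_ge0//.
rewrite sqr_enorm !innerE (innerC y x) -!sqr_enorm sqrrD.
have := cauchy_schwarz x y; lra.
Qed.

Lemma enorm_sub x y : enorm x - enorm y <= enorm (x - y).
Proof. by have := enormD (x - y) y; rewrite subrK; lra. Qed.

Lemma ler_coord x i : `|x i 0| <= `|x|.
Proof.
rewrite [leRHS]/Num.norm /= mx_normrE; apply/bigmax_geP; right => /=.
by exists (i, 0).
Qed.

Lemma norm_le_enorm x : `|x| <= enorm x.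
Proof.
have [->//|/mx_norm_neq0[[i j] /=]] := eqVneq `|x| 0.
rewrite (ord1 j) [leLHS]/Num.norm/= => ->.
rewrite -sqrtr_sqr ler_wsqrtr// /inner (bigD1 i)//= -expr2 lerDl.
by apply: sumr_ge0 => k _; rewrite -expr2 sqr_ge0.
Qed.

(** The crude factor [n + 1] in place of the square root of [n] is positive for every [n], so that
    one can divide by it. *)
Lemma enorm_le_norm x : enorm x <= n.+1%:R * `|x|.
Proof.
rewrite -(@ler_pXn2r _ 2) ?nnegrE// ?mulr_ge0// sqr_enorm.
apply: (@le_trans _ _ (\sum_(i < n) `|x| ^+ 2)).
  apply: ler_sum => i _; rewrite -expr2 -(ger0_norm (sqr_ge0 (x i 0))) normrX.
  by rewrite ler_pXn2r ?nnegrE// ler_coord.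
rewrite sumr_const card_ord -[_ *+ n]mulr_natl exprMn ler_wpM2r ?sqr_ge0//.
by rewrite -natrX ler_nat -[leqLHS]muln1 leq_mul// ltnW.
Qed.

Lemma nbhs_enormP x (P : set 'cV[R]_n) :
  nbhs x P <-> exists2 e, 0 < e & forall y, enorm (y - x) < e -> P y.
Proof.
split=> [|[e e0 xP]].
  move=> /nbhs_normP[e /= e0 xP]; exists e => // y yx; apply: xP => /=.
  by rewrite distrC (le_lt_trans (norm_le_enorm _)).
apply/(@nbhs_normP _ 'cV[R]_n); exists (e / n.+1%:R) => /=.
  by rewrite divr_gt0.
move=> y /=; rewrite distrC ltr_pdivlMr// mulrC => yx; apply: xP.
exact: le_lt_trans (enorm_le_norm _) _.
Qed.

Lemma cvg_enormP (xs : nat -> 'cV[R]_n) x :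
  xs @ \oo --> x <->
  forall e, 0 < e -> \forall k \near \oo, enorm (xs k - x) < e.
Proof.
split=> [xsx e e0|h].
  apply: (xsx [set y | enorm (y - x) < e]).
  by apply/nbhs_enormP; exists e.
by move=> P /nbhs_enormP[e e0 eP]; apply: filterS (h _ e0) => k; exact: eP.
Qed.

Definition elipschitz (L : R) (w : 'cV[R]_n -> R) :=
  forall x y, `|w x - w y| <= L * enorm (x - y).

Lemma elipschitz_ub (L : R) w x y : elipschitz L w ->
  w x <= w y + L * enorm (x - y).
Proof. by move=> /(_ x y); rewrite ler_norml => /andP[_]; lra. Qed.

Lemma near_elipschitz (L : R) w x e : elipschitz L w -> 0 < e ->
  \forall y \near x, `|w y - w x| < e.
Proof.
move=> wL e0; apply/nbhs_enormP; exists (e / (`|L| + 1)) => [|y].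
  by rewrite divr_gt0// ltr_wpDl.
rewrite ltr_pdivlMr ?ltr_wpDl// => h; apply: le_lt_trans (wL _ _) _.
apply: le_lt_trans h; rewrite mulrC ler_wpM2l//.
by have := ler_norm L; lra.
Qed.

Lemma elipschitz_continuous (L : R) w : elipschitz L w -> continuous w.
Proof.
move=> wL x P /nbhs_normP[e /= e0 eP].
by apply: filterS (near_elipschitz x wL e0) => y xy; apply: eP; rewrite /= distrC.
Qed.

Lemma elipschitz_enormB x : elipschitz 1 (fun y => enorm (y - x)).
Proof.
move=> y z; rewrite mul1r ler_norml; apply/andP; split.
  have := enorm_sub (z - x) (y - x).
  by rewrite opprB addrA subrK (enormB y z); lra.
have := enorm_sub (y - x) (z - x).
by rewrite opprB addrA subrK; lra.
Qed.

Lemma enorm_continuous : continuous (@enorm R n).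
Proof.
apply: (@elipschitz_continuous 1) => x y; have := elipschitz_enormB 0 x y.
by rewrite !subr0.
Qed.

Lemma elipschitz_inner y : elipschitz (enorm y) (inner y).
Proof.
move=> a b; rewrite -innerNr -innerDr ler_norml cauchy_schwarz andbT.
by rewrite lerNl -innerNr (le_trans (cauchy_schwarz _ _))// enormN.
Qed.

Lemma trmx_continuous m k : continuous (@trmx R m k).
Proof.
move=> M P /nbhs_ballP[e e0 MP]; apply/nbhs_ballP; exists e => // N [_ MN].
by apply: MP; split=> // i j; rewrite !mxE; exact: MN.
Qed.

Lemma compact_enorm_le r : compact [set x : 'cV[R]_n | enorm x <= r].
Proof.
(* Heine-Borel in the form [bounded_closed_compact] concerns row vectors; the ball is the image of
   its row version under transposition. *)
have cr : compact [set v : 'rV[R]_n | enorm v^T <= r].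
  apply: bounded_closed_compact.
    exists r; split; first exact: num_real.
    move=> M rM v /= vr; rewrite (le_trans _ (ltW rM))// (le_trans _ vr)//.
    apply: le_trans (norm_le_enorm _).
    rewrite /Num.norm/= !mx_normrE; apply/bigmax_leP; split.
      by apply/bigmax_geP; left.
    move=> -[i j] _ /=; apply/bigmax_geP; right.
    by exists (j, i) => //=; rewrite mxE.
  have : continuous (fun v : 'rV[R]_n => enorm v^T).
    move=> v; apply: continuous_comp; last exact: enorm_continuous.
    exact: trmx_continuous.
  move=> /continuous_closedP /(_ _ (@closed_le _ r)).
  by apply.
have := @continuous_compact 'rV[R]_n 'cV[R]_n trmx _ _ cr.
rewrite (_ : trmx @` _ = [set x | enorm x <= r]); last first.
  apply/seteqP; split=> [_ [v /= vr <-]//|x /= xr].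
  by exists x^T => //=; rewrite trmxK.
apply; apply: continuous_subspaceT; exact: trmx_continuous.
Qed.

Lemma compact_sphere s : compact [set x : 'cV[R]_n | enorm x = s].
Proof.
apply: (subclosed_compact _ (@compact_enorm_le s)) => [|x /= ->//].
have /continuous_closedP /(_ _ (@closed_eq _ s)) := enorm_continuous.
by [].
Qed.

Lemma reflectionD u x y : reflection u (x + y) = reflection u x + reflection u y.
Proof.
by rewrite /reflection innerDl mulrDr scalerDl opprD addrACA.
Qed.

Lemma reflectionZ u a x : reflection u (a *: x) = a *: reflection u x.
Proof.
by rewrite /reflection innerZl scalerBr scalerA; congr (_ - _ *: _); ring.
Qed.

Lemma reflectionN u x : reflection u (- x) = - reflection u x.
Proof. by rewrite -scaleN1r reflectionZ scaleN1r. Qed.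

Lemma usphere_inner u : usphere u -> inner u u = 1.
Proof. by rewrite -sqr_enorm => ->; rewrite expr1n. Qed.

Lemma inner_reflection u x y : inner (reflection u x) y = inner x (reflection u y).
Proof. by rewrite /reflection !innerE (innerC u y); ring. Qed.

Lemma reflectionK u : usphere u -> involutive (reflection u).
Proof.
move=> /usphere_inner u1 x; rewrite /reflection !innerE u1 mulr1.
have -> : 2 * (inner x u - 2 * inner x u) = - (2 * inner x u) by ring.
by rewrite scaleNr opprK subrK.
Qed.

Lemma enorm_reflection u x : usphere u -> enorm (reflection u x) = enorm x.
Proof.
by move=> u1; apply: enorm_eqP; rewrite inner_reflection reflectionK.
Qed.

Lemma enorm_reflectionB u x y : usphere u ->
  enorm (reflection u x - reflection u y) = enorm (x - y).
Proof.
by move=> u1; rewrite -reflectionN -reflectionD enorm_reflection.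
Qed.

(** The normal is [x - y] normalized: equality of the norms gives [2 <x, x - y> = |x - y|^2], so
    reflecting [x] subtracts exactly [x - y]. *)
Lemma reflection_transitive x y : enorm x = enorm y -> x != y ->
  exists2 u, usphere u & reflection u x = y.
Proof.
move=> xy xNy.
have d0 : enorm (x - y) != 0.
  by apply: contra xNy => /eqP/enorm_eq0/eqP; rewrite subr_eq0.
exists ((enorm (x - y))^-1 *: (x - y)).
  by rewrite /usphere/= enormZ ger0_norm ?invr_ge0// mulVf.
rewrite /reflection scalerA innerZr.
have -> : 2 * ((enorm (x - y))^-1 * inner x (x - y)) * (enorm (x - y))^-1 = 1.
  have : 2 * inner x (x - y) = enorm (x - y) ^+ 2.
    have := congr1 (fun t => t ^+ 2) xy; rewrite !sqr_enorm !innerE (innerC y x).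
    by move=> ->; ring.
  move=> h; have -> : 2 * ((enorm (x - y))^-1 * inner x (x - y)) *
    (enorm (x - y))^-1 = 2 * inner x (x - y) / enorm (x - y) ^+ 2 by field.
  by rewrite h divff// expf_neq0.
by rewrite scale1r subKr.
Qed.

Lemma inner_mulmx (A : 'M[R]_n) x y : inner (A *m x) y = inner x (A^T *m y).
Proof.
have E (a b : 'cV[R]_n) : inner a b = (a^T *m b) 0 0.
  by rewrite mxE; apply: eq_bigr => i _; rewrite mxE.
by rewrite !E trmx_mul mulmxA.
Qed.

Lemma orthogonal_tr (A : 'M[R]_n) : orthogonal_group A -> orthogonal_group A^T.
Proof. by rewrite /orthogonal_group/= trmxK => /mulmx1C. Qed.

Lemma orthogonal_trmx_mul (A : 'M[R]_n) : orthogonal_group A -> A^T *m A = 1%:M.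
Proof. by move=> /mulmx1C. Qed.

Lemma orthogonal_invmx (A : 'M[R]_n) : orthogonal_group A -> invmx A = A^T.
Proof.
move=> AA; have Au : A \in unitmx by case/mulmx1_unit: (AA).
by rewrite -[RHS](mulKmx Au) AA mulmx1.
Qed.

Lemma enorm_orthogonal (A : 'M[R]_n) x : orthogonal_group A ->
  enorm (A *m x) = enorm x.
Proof.
move=> AA; apply: enorm_eqP.
by rewrite inner_mulmx mulmxA orthogonal_trmx_mul// mul1mx.
Qed.

Definition reflection_mx u : 'M[R]_n := 1%:M - 2 *: (u *m u^T).

Lemma reflection_mxE u x : reflection_mx u *m x = reflection u x.
Proof.
rewrite mulmxBl mul1mx -scalemxAl -mulmxA /reflection -scalerA; congr (_ - _).
congr (_ *: _); apply/colP => i; rewrite !mxE big_ord1 !mxE mulrC.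
by congr (_ * _); apply: eq_bigr => j _; rewrite !mxE mulrC.
Qed.

Lemma orthogonal_reflection_mx u : usphere u -> orthogonal_group (reflection_mx u).
Proof.
move=> u1; have tr : (reflection_mx u)^T = reflection_mx u.
  by rewrite /reflection_mx linearB/= trmx1 linearZ/= trmx_mul trmxK.
rewrite /orthogonal_group/= tr.
(* The matrix being symmetric, orthogonality is the involution property read column by column. *)
apply/matrixP => i j; have /colP/(_ i) := reflectionK u1 (delta_mx j 0).
by rewrite -!reflection_mxE mulmxA -colE !mxE eqxx andbT.
Qed.

End EuclideanSpace.
#[global] Hint Extern 0 (is_true (0 <= enorm _)) => exact: enorm_ge0 : core.

(** * Proximal points and Fenchel-Moreau duality *)

(** By monotonicity in [N] a finite subcover is governed by its largest index. It serves in place of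
    subsequence extraction, both to attain minima and for an argument in the style of Dini. *)
Lemma compact_uniform (T : topologicalType) (K : set T) (P : nat -> T -> Prop) :
  compact K -> (forall N x, P N x -> P N.+1 x) ->
  (forall x, K x -> exists N, \forall y \near x, P N y) ->
  exists N, forall x, K x -> P N x.
Proof.
move=> /compact_near_coveringP cK Pmono KP.
have mono N M x : (N <= M)%N -> P N x -> P M x.
  move=> NM; rewrite -(subnK NM); elim: (M - N)%N => [//|k IH] /IH.
  by rewrite addSn; apply: Pmono.
have [|N _ NP] := cK nat \oo P _; last by exists N; apply: NP => /=.
move=> x Kx; have [N NP] := KP x Kx.
exists ([set y | P N y], [set M | (N <= M)%N]) => /=.
  by split => //; exists N.
by move=> [y M] /= [Py NM]; exact: mono Py.
Qed.

Lemma near_continuous (R : realType) (T : topologicalType) (f : T -> R) x e :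
  continuous f -> 0 < e -> \forall y \near x, `|f y - f x| < e.
Proof.
move=> cf e0; apply: (cf x [set t | `|t - f x| < e]).
by apply/nbhs_normP; exists e => // t /=; rewrite distrC.
Qed.

Section ConvexAnalysis.
Context {R : realType} {n : nat}.
Implicit Types (x y z u p q : 'cV[R]_n) (G H : 'cV[R]_n -> \bar R).
Implicit Types (a b c m r s t v : R).

(** Convexity of the epigraph: only real bounds occur, so no sum or product of infinite values needs
    an interpretation. *)
Definition epi_convex G := forall x y a b (l : R),
  (G x <= a%:E)%E -> (G y <= b%:E)%E -> 0 <= l <= 1 ->
  (G (l *: x + (1 - l) *: y)%R <= (l * a + (1 - l) * b)%:E)%E.

Definition epi_proper G := exists x v, (G x <= v%:E)%E.

Lemma lsc_near G x a : lower_semicontinuous G -> (a%:E < G x)%E ->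
  \forall y \near x, (a%:E < G y)%E.
Proof. by move=> lG /lG[V xV VG]; exact: filterS xV. Qed.

Lemma le_legendre G x y v : (G y <= v%:E)%E ->
  ((inner x y - v)%:E <= legendre G x)%E.
Proof.
move=> Gv; apply: (@le_trans _ _ ((inner x y)%:E - G y)%E).
  by rewrite EFinB leeB.
by apply: ereal_sup_ubound; exists y.
Qed.

Lemma legendre_leP G x c : (legendre G x <= c%:E)%E <->
  forall y v, (G y <= v%:E)%E -> inner x y - v <= c.
Proof.
split=> [h y v Gv|h].
  by rewrite -lee_fin; apply: le_trans h; exact: le_legendre.
apply: ge_ereal_sup => _ [y _ <-].
case E : (G y) => [v| |].
- by rewrite -EFinB lee_fin; apply: h; rewrite E.
- by rewrite addeNy leNye.
- exfalso; have := h y (inner x y - c - 1); rewrite E leNye => /(_ isT).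
  lra.
Qed.

Lemma legendre_gtP G x c : (c%:E < legendre G x)%E <->
  exists y v, (G y <= v%:E)%E /\ c < inner x y - v.
Proof.
split=> [|[y [v [Gv cv]]]]; last first.
  by apply: lt_le_trans (le_legendre _ Gv); rewrite lte_fin.
rewrite ltNge => h; apply/not_existsP => h'; move/negP: h; apply.
apply/legendre_leP => y v Gv; rewrite leNgt; apply/negP => cv.
by apply: (h' y); exists v.
Qed.

(* The minimizer [p] of [G + c/2 |. - x|^2]; convexity along the segment from
   [p] to [z] turns minimality into the subgradient inequality. *)
Lemma proximal_point G m x c : epi_convex G -> lower_semicontinuous G ->
  (forall y, (m%:E <= G y)%E) -> epi_proper G -> 0 < c ->
  exists p r, G p = r%:E /\
    forall z v, (G z <= v%:E)%E -> r + c * inner (x - p) (z - p) <= v.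
Proof.
move=> cvG lG mG [x0 [v0 Gx0]] c0.
pose q z := c / 2 * enorm (z - x) ^+ 2.
have q0 z : 0 <= q z by rewrite mulr_ge0 ?sqr_ge0// divr_ge0// ltW.
have cq : continuous q.
  move=> z; apply: (@continuous_comp _ _ _ (fun z => enorm (z - x)) (fun t => c / 2 * t ^+ 2)).
    exact: (elipschitz_continuous (elipschitz_enormB x)).
  by apply: cvgM; [exact: cvg_cst|exact: exprn_continuous].
pose S := [set t | exists z v, (G z <= v%:E)%E /\ t = v + q z].
have S0 : S !=set0 by exists (v0 + q x0), x0, v0.
have Sm : lbound S m.
  move=> _ [z [v [Gz ->]]]; have : m <= v by rewrite -lee_fin (le_trans (mG z)).
  by have := q0 z; lra.
have hS : has_inf S by split => //; exists m.
have [p [r [Gp rp]]] : exists p r, G p = r%:E /\ r + q p <= inf S.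
  apply: contrapT => h.
  have Gq p : ((inf S - q p)%:E < G p)%E.
    rewrite ltNge; apply/negP => Gp; apply: h; exists p, (fine (G p)).
    have Gfin : G p \is a fin_num.
      rewrite fin_numE; apply/andP; split.
        by apply: contraTneq (mG p) => ->.
      by apply: contraTneq Gp => ->.
    by rewrite fineK//; split => //; move: Gp; rewrite -(fineK Gfin) lee_fin; lra.
  (* As [rho >= 1], a point at distance more than [rho] from [x] has [q] at least
     [c / 2 * rho > inf S + 1 - m]; since [G >= m], no point that comes within 1 of the infimum lies
     that far away. *)
  pose rho := 2 / c * (inf S + 1 - m) + 1.
  have [||p _|N NP] := @compact_uniform _ [set z | enorm z <= rho + enorm x]
     (fun N z => ((inf S - q z + N.+1%:R^-1)%:E < G z)%E).
  - exact: (@compact_enorm_le R n (rho + enorm x)).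
  - move=> N z; apply: le_lt_trans; rewrite lee_fin lerD2l lef_pV2 ?posrE//.
    by rewrite ler_nat.
  - have := Gq p => Gp.
    have [N NP] : exists N, ((inf S - q p + 2 * N.+1%:R^-1)%:E < G p)%E.
      case E : (G p) Gp => [r| |]//; last by exists 0%N; rewrite ltry.
      rewrite lte_fin => Gp.
      exists (Num.truncn (2 / (r - inf S + q p))); rewrite lte_fin.
      rewrite -ltrBrDl.
      have d0 : 0 < r - inf S + q p by lra.
      rewrite -(_ : r - inf S + q p = r - (inf S - q p)); last by ring.
      rewrite ltr_pdivrMr// mulrC -ltr_pdivrMr//; exact: Num.Theory.truncnS_gt.
    exists N; have := lsc_near lG NP.
    have N0 : 0 < N.+1%:R^-1 :> R by rewrite invr_gt0.
    have := near_continuous p cq N0.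
    apply: filterS2 => y; rewrite ltr_norml => /andP[h1 h2].
    apply: le_lt_trans; rewrite lee_fin.
    by move: h1 h2; move: (N.+1%:R^-1) => e h1 h2; lra.
  have N0 : 0 < N.+1%:R^-1 :> R by rewrite invr_gt0.
  have N1 : N.+1%:R^-1 <= 1 :> R by rewrite invf_le1// ler1n.
  move: N0 N1 NP; move: (N.+1%:R^-1) => e N0 N1 NP.
  have [_ [z [v [Gz ->]]] vS] := inf_adherent N0 hS.
  have [zr|zr'] := leP (enorm z) (rho + enorm x).
    by have := lt_le_trans (NP z zr) Gz; rewrite lte_fin; lra.
  have zr : rho < enorm (z - x) by have := enorm_sub z x; lra.
  have mv : m <= v by rewrite -lee_fin (le_trans (mG z)).
  have mS : m <= inf S by apply: lb_le_inf.
  have rho1 : 1 <= rho.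
    by rewrite lerDr mulr_ge0// ?divr_ge0// ?ltW//; lra.
  have : rho <= enorm (z - x) ^+ 2.
    by rewrite (le_trans (ltW zr))// expr2 ler_peMl//; lra.
  rewrite -(ler_pM2l (_ : 0 < c / 2)) ?divr_gt0// -/(q z).
  have -> : c / 2 * rho = inf S + 1 - m + c / 2 by rewrite /rho; field; exact: lt0r_neq0.
  lra.
exists p, r; split => // z v Gz.
apply/ler_addgt0Pr => e e0.
pose k := c / 2 * enorm (z - p) ^+ 2.
have k0 : 0 <= k by rewrite mulr_ge0 ?sqr_ge0// divr_ge0// ltW.
have ke : 0 < k + e by rewrite ltr_wpDl.
(* An explicit substitute for letting [l] tend to 0: [l * k <= e], so the quadratic term
   [l ^+ 2 * k] contributes at most [e] after division by [l]. *)
pose l := e / (k + e).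
have l01 : 0 <= l <= 1.
  apply/andP; split; first by rewrite divr_ge0 ?ltW.
  by rewrite ler_pdivrMr// mul1r lerDr.
have l0 : 0 < l by rewrite divr_gt0.
have lk : l * k <= e.
  by rewrite /l mulrAC ler_pdivrMr// ler_wpM2l ?(ltW e0)// lerDl ltW.
clearbody l.
have Gp' : (G p <= r%:E)%E by rewrite Gp.
have Gl := cvG _ _ _ _ l Gz Gp' l01.
have : inf S <= l * v + (1 - l) * r + q (l *: z + (1 - l) *: p).
  by apply: ge_inf; [exists m|exists (l *: z + (1 - l) *: p), (l * v + (1 - l) * r)].
have -> : q (l *: z + (1 - l) *: p) =
    q p - c * l * inner (x - p) (z - p) + l ^+ 2 * k.
  rewrite /q /k (_ : _ + _ - x = (p - x) + l *: (z - p)); last first.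
    by apply/colP => i; rewrite !mxE; ring.
  rewrite -[x - p]opprB innerNl !sqr_enorm.
  move: (p - x) (z - p) => d f; by rewrite !innerE (innerC f d); field.
move=> h.
rewrite -(ler_pM2l l0).
have : l * (l * k) <= l * e by rewrite ler_pM2l.
by move: h rp; rewrite expr2; lra.
Qed.

Lemma legendre_legendre_le G x : (legendre (legendre G) x <= G x)%E.
Proof.
case E : (G x) => [r| |]; last 2 first.
- by rewrite leey.
- apply: ge_ereal_sup => _ [y _ <-].
  suff -> : legendre G y = +oo%E by rewrite addeNy.
  apply/eqyP => A _; apply: le_trans (_ : ((inner y x - (inner y x - A))%:E <= _)%E).
    by rewrite lee_fin; lra.
  by apply: le_legendre; rewrite E leNye.
apply/legendre_leP => y v /legendre_leP /(_ x r); rewrite E lexx => /(_ isT).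
by rewrite innerC; lra.
Qed.

Lemma fenchel_moreau G m : epi_convex G -> lower_semicontinuous G ->
  (forall y, (m%:E <= G y)%E) -> epi_proper G ->
  forall x, legendre (legendre G) x = G x.
Proof.
move=> cvG lG mG pG x; apply/eqP; rewrite eq_le legendre_legendre_le/=.
have key a : (a%:E < G x)%E -> (a%:E <= legendre (legendre G) x)%E.
  move=> /(lsc_near lG)/nbhs_enormP[d d0 dG].
  (* The affine minorant at the proximal point [p] has the value [G p + c |x - p|^2] at [x]. For
     this [c] it is at least [a] in both cases: if [|x - p| < d] then [G p > a], and otherwise the
     quadratic term is at least [|a - m| + 1] while [G p >= m]. *)
  have c0 : 0 < (`|a - m| + 1) / d ^+ 2 by rewrite divr_gt0 ?exprn_gt0 ?ltr_wpDl.
  have [p [r [Gp pr]]] := @proximal_point G m x _ cvG lG mG pG c0.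
  move: c0 pr; set c := _ / _ => c0 pr.
  have Gy : (legendre G (c *: (x - p)) <= (c * inner (x - p) p - r)%:E)%E.
    apply/legendre_leP => z v /pr; rewrite innerZl innerDr innerNr; lra.
  apply: le_trans (le_legendre x Gy); rewrite lee_fin.
  rewrite innerZr (innerC x) opprB addrCA -mulrBr -innerNr -innerDr -sqr_enorm.
  have [pd|pd] := ltP (enorm (p - x)) d.
    have : a < r by rewrite -lte_fin -Gp; exact: dG.
    by have := mulr_ge0 (ltW c0) (sqr_ge0 (enorm (x - p))); lra.
  have mr : m <= r by rewrite -lee_fin -Gp.
  rewrite enormB in pd.
  have : d ^+ 2 <= enorm (x - p) ^+ 2 by rewrite !expr2 ler_pM// ltW.
  rewrite -(ler_pM2l c0) /c mulfVK ?gt_eqF ?exprn_gt0//.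
  by have := ler_norm (a - m); lra.
case E : (G x) (mG x) key => [r| |]// _ key.
  by apply/lee_subgt0Pr => e e0; rewrite -EFinB key// lte_fin; lra.
by rewrite leye_eq; apply/eqP/eqyP => A _; apply: key; rewrite ltry.
Qed.

Lemma legendre_radial (G : 'cV[R]_n -> \bar R) : radial G -> radial (legendre G).
Proof.
move=> rG; have le A x : orthogonal_group A -> (legendre G (A *m x) <= legendre G x)%E.
  move=> OA; apply: ge_ereal_sup => _ [y _ <-].
  rewrite inner_mulmx -(rG _ (orthogonal_tr OA)).
  by apply: ereal_sup_ubound; exists (A^T *m y).
move=> A OA y; apply/eqP; rewrite eq_le; apply/andP; split; first exact: le.
have {1}-> : y = A^T *m (A *m y) by rewrite mulmxA orthogonal_trmx_mul// mul1mx.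
by apply: le; exact: orthogonal_tr.
Qed.

Lemma legendre_convex (G : 'cV[R]_n -> \bar R) : epi_convex (legendre G).
Proof.
move=> x y c d l /legendre_leP xc /legendre_leP yd /andP[l0 l1].
apply/legendre_leP => z v Gz; have := ler_wpM2l l0 (xc z v Gz).
have : 0 <= 1 - l by lra.
by move=> /ler_wpM2l/(_ _ _ (yd z v Gz)); rewrite innerDl !innerZl; lra.
Qed.

Lemma legendre_lsc (G : 'cV[R]_n -> \bar R) : lower_semicontinuous (legendre G).
Proof.
move=> x c /legendre_gtP[y [v [Gy cv]]].
have d0 : 0 < inner y x - v - c by rewrite innerC; lra.
exists [set z | `|inner y z - inner y x| < inner y x - v - c].
  exact: near_elipschitz (elipschitz_inner y) d0.
move=> z /=; rewrite ltr_norml => /andP[h _].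
apply: lt_le_trans (le_legendre z Gy); rewrite lte_fin (innerC z); lra.
Qed.

Lemma epi_convex_le (G : 'cV[R]_n -> \bar R) x y (l : R) : epi_convex G ->
  (forall z, G z != -oo%E) -> 0 <= l <= 1 ->
  (G (l *: x + (1 - l) *: y)%R <= l%:E * G x + (1 - l)%:E * G y)%E.
Proof.
move=> cG G0 /andP[l0 l1].
have [->|l0'] := eqVneq l 0.
  by rewrite scale0r add0r subr0 scale1r mul0e mul1e add0e.
have [->|l1'] := eqVneq l 1.
  by rewrite subrr scale0r addr0 scale1r mul0e mul1e adde0.
have lp : 0 < l by rewrite lt0r l0'.
have lp' : 0 < 1 - l by rewrite subr_gt0 lt_neqAle l1'.
have := G0 x; have := G0 y.
case Ex : (G x) => [r| |]//; case Ey : (G y) => [s| |]// _ _.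
- rewrite -!EFinM -EFinD; apply: cG; rewrite ?Ex ?Ey ?lexx//.
  by rewrite l0.
- by rewrite gt0_muley// -EFinM addey// leey.
- by rewrite gt0_muley// -EFinM addye// leey.
- by rewrite !gt0_muley// leey.
Qed.

End ConvexAnalysis.

(** * Infimal averages and their Legendre transforms *)

Section ReflectionAverages.
Context {R : realType} {n : nat}.
Implicit Types (x y z u p q : 'cV[R]_n) (G : 'cV[R]_n -> \bar R).
Implicit Types (w : 'cV[R]_n -> R) (a b c m r s t v : R).

Definition inf_avg u G x : \bar R :=
  ereal_inf [set t%:E | t in [set t | exists p q a b,
    [/\ p + reflection u q = 2 *: x, (G p <= a%:E)%E, (G q <= b%:E)%E &
        t = (a + b) / 2]]].

Definition avg u w y : R := (w y + w (reflection u y)) / 2.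

Lemma inf_avg_le u G x p q a b : p + reflection u q = 2 *: x ->
  (G p <= a%:E)%E -> (G q <= b%:E)%E -> (inf_avg u G x <= ((a + b) / 2)%:E)%E.
Proof.
move=> pq Ga Gb; apply: ereal_inf_lbound; exists ((a + b) / 2) => //.
by exists p, q, a, b.
Qed.

Lemma inf_avg_geP u G x c : (c%:E <= inf_avg u G x)%E <->
  forall p q a b, p + reflection u q = 2 *: x ->
    (G p <= a%:E)%E -> (G q <= b%:E)%E -> c <= (a + b) / 2.
Proof.
split=> [h p q a b pq Ga Gb|h].
  by rewrite -lee_fin (le_trans h)//; exact: inf_avg_le pq Ga Gb.
apply: le_ereal_inf_tmp => _ [_ [p [q [a [b [pq Ga Gb ->]]]]] <-].
by rewrite lee_fin; exact: h pq Ga Gb.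
Qed.

Lemma inf_avg_ltP u G x c : (inf_avg u G x < c%:E)%E ->
  exists p q a b, [/\ p + reflection u q = 2 *: x, (G p <= a%:E)%E,
    (G q <= b%:E)%E & (a + b) / 2 < c].
Proof.
rewrite ltNge => h; apply/not_existsP => h'; move/negP: h; apply.
apply/inf_avg_geP => p q a b pq Ga Gb; rewrite leNgt; apply/negP => abc.
by apply: (h' p); exists q, a, b.
Qed.

Lemma inf_avg_leP u G x c e : 0 < e -> (inf_avg u G x <= c%:E)%E ->
  exists p q a b, [/\ p + reflection u q = 2 *: x, (G p <= a%:E)%E,
    (G q <= b%:E)%E & (a + b) / 2 < c + e].
Proof.
by move=> e0 h; apply: inf_avg_ltP; rewrite (le_lt_trans h)// lte_fin ltrDl.
Qed.

Lemma midpointE x p q : p + q = 2 *: x -> x = 2^-1 *: (p + q).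
Proof. by move=> ->; rewrite scalerA mulVf ?scale1r. Qed.

Lemma inf_avg_convex u G : epi_convex G -> epi_convex (inf_avg u G).
Proof.
move=> cG x y a b l Ga Gb l01; apply/lee_addgt0Pr => e e0.
have [p [q [a1 [b1 [pq Gp Gq ab1]]]]] := inf_avg_leP e0 Ga.
have [p' [q' [a2 [b2 [pq' Gp' Gq' ab2]]]]] := inf_avg_leP e0 Gb.
have {cG} [GP GQ] := (cG _ _ _ _ l Gp Gp' l01, cG _ _ _ _ l Gq Gq' l01).
apply: le_trans (inf_avg_le _ GP GQ) _.
  rewrite reflectionD !reflectionZ addrACA -!scalerDr pq pq'.
  by apply/colP => i; rewrite !mxE; ring.
rewrite -EFinD lee_fin; case/andP: l01 => l0 l1.
have := ler_wpM2l l0 (ltW ab1); have : 0 <= 1 - l by lra.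
by move=> /ler_wpM2l/(_ _ _ (ltW ab2)); lra.
Qed.

(** Quantitative coercivity, in a form that infimal averages preserve with the same constants. *)
Definition linear_growth a b G := forall x, ((a * enorm x + b)%:E <= G x)%E.

Lemma inf_avg_growth u G a b : usphere u -> 0 <= a ->
  linear_growth a b G -> linear_growth a b (inf_avg u G).
Proof.
move=> u1 a0 gG x; apply/inf_avg_geP => p q c d pq Gc Gd.
have := le_trans (gG p) Gc; have := le_trans (gG q) Gd; rewrite !lee_fin.
have := enormD p (reflection u q); rewrite pq enormZ ger0_norm// enorm_reflection//.
move=> /(ler_wpM2l a0); lra.
Qed.

(** Distributes a strict lower bound on a sum over the two terms, so that lower semicontinuity can
    be applied to each term separately. *)
Lemma split_sum_lt (A B : \bar R) c m : (m%:E <= A)%E -> (m%:E <= B)%E ->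
  (forall a b, (A <= a%:E)%E -> (B <= b%:E)%E -> c < a + b) ->
  exists a b, [/\ (a%:E < A)%E, (b%:E < B)%E & c <= a + b].
Proof.
case: A => [a| |]// + + h; last first.
  move=> _ mB; exists (c - m + 1), (m - 1); split; last lra.
    by rewrite ltry.
  by apply: lt_le_trans mB; rewrite lte_fin; lra.
case: B h => [b| |]// h ma mb; last first.
  exists (a - 1), (c - a + 1); split; [|by rewrite ltry|lra].
  by rewrite lte_fin; lra.
have := h a b; rewrite !lexx => /(_ isT isT) cab.
exists (a - (a + b - c) / 2), (b - (a + b - c) / 2).
by split; rewrite ?lte_fin; lra.
Qed.

(** An infimum over all [p] need not preserve lower semicontinuity. Growth confines the relevant [p]
    to a ball, and compactness makes the neighbourhood of [x] uniform in [p]. *)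
Lemma inf_avg_lsc u G a b : usphere u -> 0 < a -> linear_growth a b G ->
  lower_semicontinuous G -> lower_semicontinuous (inf_avg u G).
Proof.
move=> u1 a0 gG lG x c cx.
have Gb p : (b%:E <= G p)%E.
  by apply: le_trans (gG p); rewrite lee_fin lerDr mulr_ge0// ltW.
have [c' [cc' c'x]] : exists c', c < c' /\ (c'%:E < inf_avg u G x)%E.
  case: (inf_avg u G x) cx => [r| |]//; rewrite ?lte_fin => cr.
    by exists ((c + r) / 2); rewrite lte_fin; split; lra.
  by exists (c + 1); rewrite ltry; split => //; lra.
(* Outside this ball the first value is at least [2 c' - b]; the second is at least [b], so the
   average is at least [c']. *)
pose rho := (`|2 * (c' - b)|) / a.
have /compact_near_coveringP/(_ _ (nbhs x) (fun y p => forall a b,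
    (G p <= a%:E)%E -> (G (reflection u (2 *: y - p)) <= b%:E)%E ->
    2 * c' <= a + b) _) := compact_enorm_le (R := R) (n := n) (r := rho).
move=> cov; eexists.
- apply: cov => p _.
  have [|a' [b' [Ga' Gb' ab']]] := split_sum_lt (c := 2 * c') (Gb p)
      (Gb (reflection u (2 *: x - p))).
    move=> a1 b1 Ga1 Gb1.
    have /inf_avg_le/(_ Ga1 Gb1) : p + reflection u (reflection u (2 *: x - p)) = 2 *: x.
      by rewrite reflectionK// addrC subrK.
    move=> /(lt_le_trans c'x); rewrite lte_fin; lra.
  have /nbhs_enormP[d d0 dG] := lsc_near lG Gb'.
  exists ([set p' | (a'%:E < G p')%E] `&` [set p' | enorm (p' - p) < d / 2],
          [set y | enorm (y - x) < d / 4]) => /=.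
    split; last by apply/nbhs_enormP; exists (d / 4) => //; lra.
    apply: filterI; first exact: lsc_near.
    by apply/nbhs_enormP; exists (d / 2) => //; lra.
  move=> [p' y] /= [[ap' p'p] yx] a1 b1 Ga1 Gb1.
  have : (b'%:E < G (reflection u (2 *: y - p')))%E.
    apply: dG; rewrite enorm_reflectionB//.
    rewrite (_ : _ - _ = 2 *: (y - x) - (p' - p)); last first.
      by apply/colP => i; rewrite !mxE; ring.
    apply: le_lt_trans (enormD _ _) _; rewrite enormN enormZ ger0_norm//; lra.
  move=> /lt_le_trans/(_ Gb1); have := lt_le_trans ap' Ga1.
  rewrite !lte_fin; lra.
- move=> y Vy.
  apply: (@lt_le_trans _ _ c'%:E); first by rewrite lte_fin.
  apply/inf_avg_geP => p q a1 b1 pq Ga1 Gb1.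
  have qE : q = reflection u (2 *: y - p).
    by rewrite -pq addrAC subrr add0r reflectionK.
  have [pr|pr] := leP (enorm p) rho.
    by have := Vy p pr _ _ Ga1; rewrite -qE => /(_ _ Gb1); lra.
  have := le_trans (gG p) Ga1; have := le_trans (Gb q) Gb1; rewrite !lee_fin.
  have : a * rho <= a * enorm p by rewrite ler_pM2l// ltW.
  rewrite /rho mulrC mulfVK ?gt_eqF//; have := ler_norm (2 * (c' - b)); lra.
Qed.

(** That conjugation turns infimal averages into averages is split into two comparisons with real
    functions, because [legendre G] may be infinite. The upper one needs finiteness on a single
    sphere only, since reflections preserve spheres. *)
Lemma legendre_inf_avg_ge u G w : (forall y, ((w y)%:E <= legendre G y)%E) ->
  forall y, ((avg u w y)%:E <= legendre (inf_avg u G) y)%E.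
Proof.
move=> wG y; apply/lee_subgt0Pr => e e0; rewrite -EFinB.
have lt z : ((w z - e)%:E < legendre G z)%E.
  by apply: lt_le_trans (wG z); rewrite lte_fin; lra.
have /legendre_gtP[p [a [Ga pa]]] := lt y.
have /legendre_gtP[q [b [Gb qb]]] := lt (reflection u y).
have pq : p + reflection u q = 2 *: (2^-1 *: (p + reflection u q)).
  by rewrite scalerA divff// scale1r.
apply: le_trans (le_legendre y (inf_avg_le pq Ga Gb)).
rewrite lee_fin /avg innerZr innerDr -inner_reflection; lra.
Qed.

Lemma legendre_inf_avg_le u G w s : usphere u ->
  (forall y, enorm y = s -> (legendre G y <= (w y)%:E)%E) ->
  forall y, enorm y = s -> (legendre (inf_avg u G) y <= (avg u w y)%:E)%E.
Proof.
move=> u1 wG y ys; apply/legendre_leP => x v /inf_avg_leP xv.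
apply/ler_addgt0Pr => e /xv[p [q [a [b [/midpointE-> Ga Gb ab]]]]].
have /legendre_leP/(_ p a Ga) := wG _ ys.
have /legendre_leP/(_ q b Gb) : (legendre G (reflection u y) <= (w (reflection u y))%:E)%E.
  by apply: wG; rewrite enorm_reflection.
rewrite /avg innerZr innerDr -inner_reflection; lra.
Qed.

Fixpoint inf_avgs (u : nat -> 'cV[R]_n) G k :=
  if k is j.+1 then inf_avg (u j) (inf_avgs u G j) else G.

Fixpoint avgs (u : nat -> 'cV[R]_n) w k :=
  if k is j.+1 then avg (u j) (avgs u w j) else w.

Lemma avg_lipschitz (L : R) u w : usphere u -> elipschitz L w -> elipschitz L (avg u w).
Proof.
move=> u1 wL x y; have := wL x y; have := wL (reflection u x) (reflection u y).
rewrite enorm_reflectionB// /avg !ler_norml => /andP[h1 h2] /andP[h3 h4].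
by apply/andP; split; lra.
Qed.

(** The conjugate of [G] plus the indicator of a ball: it stays finite and [r]-Lipschitz even where
    [legendre G] is [+oo]. *)
Definition trunc_legendre G r y : R := sup [set t | exists x v,
  [/\ enorm x <= r, (G x <= v%:E)%E & t = inner y x - v]].

Section TruncatedLegendre.
Variables (G : 'cV[R]_n -> \bar R) (m : R) (x0 : 'cV[R]_n) (v0 : R).
Hypotheses (mG : forall y, (m%:E <= G y)%E) (Gx0 : (G x0 <= v0%:E)%E).
Variable r : R.
Hypothesis x0r : enorm x0 <= r.
Let S y := [set t | exists x v,
  [/\ enorm x <= r, (G x <= v%:E)%E & t = inner y x - v]].

Let hasS y : has_sup (S y).
Proof.
split; first by exists (inner y x0 - v0), x0, v0.
exists (enorm y * r - m) => _ [x [v [xr Gx ->]]].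
have : m <= v by rewrite -lee_fin (le_trans (mG x)).
have := cauchy_schwarz y x; have : enorm y * enorm x <= enorm y * r.
  by rewrite ler_wpM2l.
by lra.
Qed.

Lemma trunc_legendre_ub y x v : enorm x <= r -> (G x <= v%:E)%E ->
  inner y x - v <= trunc_legendre G r y.
Proof. by move=> xr Gx; apply: (sup_upper_bound (hasS y)); exists x, v. Qed.

Lemma trunc_legendre_le y c :
  (forall x v, enorm x <= r -> (G x <= v%:E)%E -> inner y x - v <= c) ->
  trunc_legendre G r y <= c.
Proof.
move=> h; apply: sup_le_ub; first by case: (hasS y).
by move=> _ [x [v [xr Gx ->]]]; exact: h.
Qed.

Lemma trunc_legendre_gt y c : c < trunc_legendre G r y ->
  exists x v, [/\ enorm x <= r, (G x <= v%:E)%E & c < inner y x - v].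
Proof.
move=> h; apply: contrapT => h'; move: h; apply/negP; rewrite -leNgt.
apply: trunc_legendre_le => x v xr Gx; rewrite leNgt; apply/negP => cx.
by apply: h'; exists x, v.
Qed.

Lemma trunc_legendre_lipschitz : elipschitz r (trunc_legendre G r).
Proof.
have r0 : 0 <= r by rewrite (le_trans _ x0r).
have ub y z : trunc_legendre G r y <= trunc_legendre G r z + r * enorm (y - z).
  apply: trunc_legendre_le => x v xr Gx.
  have := trunc_legendre_ub z xr Gx.
  have := cauchy_schwarz (y - z) x; rewrite innerDl innerNl.
  have : enorm (y - z) * enorm x <= enorm (y - z) * r by rewrite ler_wpM2l.
  lra.
move=> y z; have := ub y z; have := ub z y; rewrite (enormB z) ler_norml.
by move=> h1 h2; apply/andP; split; lra.
Qed.

Lemma trunc_legendre_le_legendre y : ((trunc_legendre G r y)%:E <= legendre G y)%E.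
Proof.
apply/lee_subgt0Pr => e e0; rewrite -EFinB.
have [|x [v [xr Gx h]]] := @trunc_legendre_gt y (trunc_legendre G r y - e); first lra.
by apply: le_trans (le_legendre y Gx); rewrite lee_fin ltW.
Qed.

Lemma trunc_legendre_convex y z l : 0 <= l <= 1 ->
  trunc_legendre G r (l *: y + (1 - l) *: z) <=
  l * trunc_legendre G r y + (1 - l) * trunc_legendre G r z.
Proof.
case/andP => l0 l1; apply: trunc_legendre_le => x v xr Gx.
have := ler_wpM2l l0 (trunc_legendre_ub y xr Gx).
have : 0 <= 1 - l by lra.
move=> /ler_wpM2l/(_ _ _ (trunc_legendre_ub z xr Gx)).
by rewrite innerDl !innerZl; lra.
Qed.

End TruncatedLegendre.

End ReflectionAverages.

(** * Sequences of reflections mixing every Lipschitz function *)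

Section Mixing.
Context {R : realType} {n : nat}.
Implicit Types (x y z u p q : 'cV[R]_n) (us vs : seq 'cV[R]_n).
Implicit Types (w : 'cV[R]_n -> R) (a b c m M r s t v d e : R).

Definition unit_seq us := all (fun u => enorm u == 1) us.

Definition avg_seq us w := foldl (fun w u => avg u w) w us.

Lemma avg_bounds u w s m M : usphere u ->
  (forall z, enorm z = s -> m <= w z <= M) ->
  forall z, enorm z = s -> m <= avg u w z <= M.
Proof.
move=> u1 wm z zs; have /andP[h1 h2] := wm z zs.
have /andP[] : m <= w (reflection u z) <= M by apply: wm; rewrite enorm_reflection.
by rewrite /avg => h3 h4; apply/andP; split; lra.
Qed.

Lemma avg_seq_bounds us w s m M : unit_seq us ->
  (forall z, enorm z = s -> m <= w z <= M) ->
  forall z, enorm z = s -> m <= avg_seq us w z <= M.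
Proof.
elim: us w => [//|u us IH] w /= /andP[/eqP u1 us1] wm.
exact/IH/avg_bounds.
Qed.

Lemma avg_seq_lipschitz us w (L : R) : unit_seq us -> elipschitz L w ->
  elipschitz L (avg_seq us w).
Proof.
elim: us w => [//|u us IH] w /= /andP[/eqP u1 us1] wL.
exact/IH/avg_lipschitz.
Qed.

(** One average keeps at least half of the excess over [m] at each point. So the excess at
    [reflection u z] survives, halved at each step, until [u] is applied and passes half of the rest
    on to [z]. *)
Lemma avg_seq_spread us w s m d : unit_seq us -> 0 <= d ->
  (forall z, enorm z = s -> m <= w z) ->
  forall z, enorm z = s ->
    m + d <= w z \/ (exists2 u, u \in us & m + d <= w (reflection u z)) ->
  m + d / 2 ^+ size us <= avg_seq us w z.
Proof.
elim: us w d => [|u us IH] w d /= us1 d0 wm z zs.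
  by rewrite expr0 divr1 => -[//|[]].
move: us1 => /andP[/eqP u1 us1] wz.
have avgm y : enorm y = s -> m <= avg u w y.
  move=> ys; have := wm y ys; have : m <= w (reflection u y).
    by apply: wm; rewrite enorm_reflection.
  by rewrite /avg; lra.
rewrite exprS invfM mulrA; apply: IH => //; first by rewrite divr_ge0.
have half y : enorm y = s -> m + d <= w y -> m + d / 2 <= avg u w y.
  move=> ys; have : m <= w (reflection u y) by apply: wm; rewrite enorm_reflection.
  by rewrite /avg; lra.
case: wz => [wz|[u']]; first by left; exact: half.
rewrite inE => /predU1P[->|u'us] wz.
  by left; rewrite /avg; have := wm z zs; lra.
right; exists u' => //; apply: half => //.
by rewrite enorm_reflection//; have /allP/(_ _ u'us)/eqP := us1.
Qed.

Lemma sphere_net s d : 0 < d -> exists P : seq 'cV[R]_n,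
  (forall p, p \in P -> enorm p = s) /\
  forall z, enorm z = s -> exists2 p, p \in P & enorm (z - p) < d.
Proof.
move=> d0; have := @compact_sphere R n s; rewrite compact_cover.
move=> /(_ 'cV[R]_n [set x | enorm x = s] (fun p => [set z | enorm (z - p) < d])).
case=> [p _|z zs|D Ds Dcov].
- rewrite openE => z /= zp; apply/nbhs_enormP; exists (d - enorm (z - p)).
    by rewrite subr_gt0.
  move=> y yz /=; have := enormD (y - z) (z - p); rewrite subrKA.
  by move=> /le_lt_trans; apply; rewrite -ltrBrDr.
- by exists z => //=; rewrite subrr enorm0.
exists (finmap.enum_fset D); split=> [p /Ds|z zs]; first by rewrite inE.
by have [p /= pD zp] := Dcov z zs; exists p.
Qed.

Lemma exists_unit : (0 < n)%N -> exists u : 'cV[R]_n, enorm u = 1.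
Proof.
move=> n0; exists (delta_mx (Ordinal n0) 0).
rewrite /enorm /inner (bigD1 (Ordinal n0))//= big1.
  by rewrite !mxE !eqxx mulr1 addr0 sqrtr1.
by move=> i /negPf ni; rewrite !mxE ni mul0r.
Qed.

(* Reflections sending the points of a finite net to [x0] send every point of
   the sphere close to [x0]. *)
Lemma mixing s d : (0 < n)%N -> 0 < d -> exists K : nat,
  forall x0, enorm x0 = s -> exists us, [/\ unit_seq us, size us = K &
    forall w m h, 0 <= h -> (forall z, enorm z = s -> m <= w z) ->
      (forall z, enorm z = s -> enorm (z - x0) < d -> m + h <= w z) ->
      forall z, enorm z = s -> m + h / 2 ^+ K <= avg_seq us w z].
Proof.
move=> n0 d0; have [P [Ps Pnet]] := sphere_net s d0; exists (size P) => x0 x0s.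
(* A net point equal to [x0] needs no reflection; an arbitrary unit vector is used for it, which
   keeps the number of reflections equal to [size P] for every [x0]. *)
have /choice[g gP] : forall p, exists u,
    enorm u = 1 /\ (enorm p = s -> p <> x0 -> reflection u p = x0).
  move=> p; have [[ps px]|h] := pselect (enorm p = s /\ p <> x0).
    have [||u u1 up] := @reflection_transitive R n p x0.
    - by rewrite ps x0s.
    - exact/eqP.
    by exists u.
  have [u0 u01] := exists_unit n0.
  by exists u0; split=> // ps px; exfalso; apply: h.
have us1 : unit_seq [seq g p | p <- P].
  by apply/allP => _ /mapP[p _ ->]; have [-> _] := gP p.
exists [seq g p | p <- P]; split; [by []|by rewrite size_map|].
move=> w m h h0 wm wh z zs; rewrite -(size_map g).
apply: (avg_seq_spread (s := s)) => //.
have [p pP zp] := Pnet z zs; have [gp1 gpx] := gP p.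
have [px|px] := eqVneq p x0.
  by left; apply: wh => //; rewrite -px.
right; exists (g p); first by apply/mapP; exists p.
apply: wh; first by rewrite enorm_reflection.
by rewrite -(gpx (Ps _ pP) (elimN eqP px)) enorm_reflectionB.
Qed.

(** If some point has a value at least [m + e / 2], then the values within [d] of it are at least
    [m + e / 4], and mixing raises the lower bound by [h] without raising the upper one. If there is
    no such point, the oscillation is small already. Averages keep the Lipschitz constant, so the
    same [h] works in every round. *)
Lemma osc_reduction s (L : R) e w : (0 < n)%N -> 0 <= s -> 0 <= L -> 0 < e ->
  elipschitz L w ->
  exists us m, unit_seq us /\
    forall z, enorm z = s -> m <= avg_seq us w z <= m + e.
Proof.
move=> n0 s0 L0 e0 wL.
pose d := e / (4 * (L + 1)).
have L1 : 0 < L + 1 by lra.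
have d0 : 0 < d by rewrite divr_gt0// mulr_gt0.
have Ld : L * d <= e / 4.
  have -> : e / 4 = (L + 1) * d by rewrite /d; field; exact: lt0r_neq0.
  by rewrite ler_pM2r//; lra.
have [K mixK] := mixing s n0 d0.
pose h := e / 4 / 2 ^+ K.
have h0 : 0 < h by rewrite !divr_gt0// exprn_gt0.
have main k : forall w m M, elipschitz L w ->
    (forall z, enorm z = s -> m <= w z <= M) -> M - m <= e + k%:R * h ->
    exists us m, unit_seq us /\
      forall z, enorm z = s -> m <= avg_seq us w z <= m + e.
  elim: k => [|k IH] {wL}w m M wL wm Mm.
    exists [::], m; split => // z /wm /andP[-> h2] /=.
    by rewrite mul0r addr0 in Mm; lra.
  have [[x0 [x0s x0h]]|h'] := pselect (exists x0, enorm x0 = s /\ m + e / 2 <= w x0).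
    have [us [us1 szus usP]] := mixK x0 x0s.
    have [|||vs [m' [vs1 vsP]]] := IH (avg_seq us w) (m + h) M.
    - exact: avg_seq_lipschitz.
    - move=> z zs; have /andP[_ ->] := avg_seq_bounds us1 wm zs; rewrite andbT.
      apply: (usP w m (e / 4)) => //; first lra.
        by move=> y /wm/andP[].
      move=> y ys yx0; have := elipschitz_ub x0 y wL; rewrite enormB.
      have : L * enorm (y - x0) <= L * d by rewrite ler_wpM2l// ltW.
      lra.
    - by rewrite -natr1 in Mm; lra.
    exists (us ++ vs), m'; split; first by rewrite /unit_seq all_cat; apply/andP.
    by rewrite /avg_seq foldl_cat.
  exists [::], m; split => // z zs /=; have /andP[-> _] /= := wm z zs.
  rewrite leNgt; apply/negP => zh; apply: h'; exists z; split => //; lra.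
(* On the sphere [w] stays within [L * s] of [w 0], so the initial gap [2 * L * s] bounds the number
   of rounds. *)
pose k := (Num.truncn (2 * (L * s) / h)).+1.
apply: (main k w (w 0 - L * s) (w 0 + L * s)) => //.
  move=> z zs; have := elipschitz_ub z 0 wL; have := elipschitz_ub 0 z wL.
  by rewrite sub0r subr0 enormN zs => h1 h2; apply/andP; split; lra.
have : 2 * (L * s) / h < k%:R by exact: Num.Theory.truncnS_gt.
by rewrite ltr_pdivrMr//; lra.
Qed.

Lemma avgs_mkseq (u0 : nat -> 'cV[R]_n) w k : avgs u0 w k = avg_seq (mkseq u0 k) w.
Proof.
by elim: k => [//|k IH]; rewrite mkseqS -cats1 /avg_seq foldl_cat /= IH.
Qed.

Lemma exists_mixing_sequence (wf : nat -> 'cV[R]_n -> R) (sf Lf : nat -> R) :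
  (0 < n)%N -> (forall j, 0 <= sf j) -> (forall j, 0 <= Lf j) ->
  (forall j, elipschitz (Lf j) (wf j)) ->
  exists u : nat -> 'cV[R]_n, (forall k, usphere (u k)) /\
    forall j e, 0 < e -> \forall k \near \oo, exists m,
      forall z, enorm z = sf j -> m <= avgs u (wf j) k z <= m + e.
Proof.
move=> n0 s0 L0 wL.
pose osc us j e := exists m,
  forall z, enorm z = sf j -> m <= avg_seq us (wf j) z <= m + e.
have [u0 u01] := exists_unit n0.
(* Block [i], appended to the directions [us] before it, treats the pair [(j, l)] coded by [i]:
   function [j], oscillation [1 / (l + 1)]. The extra direction [u0] makes every block nonempty, so
   that the prefixes outgrow every index. *)
have /choice[blk blkP] : forall p : nat * seq 'cV[R]_n, exists vs,
    unit_seq p.2 -> [/\ unit_seq vs, (0 < size vs)%N &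
    forall j l, unpickle p.1 = Some (j, l) -> osc (p.2 ++ vs) j l.+1%:R^-1].
  move=> [i us] /=; case: (unpickle i) => [[j l]|]; last first.
    by exists [:: u0] => us1; split => //=; rewrite u01 eqxx.
  have [us1|] := pselect (unit_seq us); last by exists [::].
  have l0 : 0 < l.+1%:R^-1 :> R by rewrite invr_gt0.
  have us01 : unit_seq (us ++ [:: u0]) 
    by rewrite /unit_seq all_cat -/(unit_seq us) us1 /= u01 eqxx.
  have [vs [m [vs1 vsP]]] := osc_reduction n0 (s0 j) (L0 j) l0
    (avg_seq_lipschitz us01 (wL j)).
  exists (u0 :: vs) => _; split => //=; first by rewrite u01 eqxx.
  move=> _ _ [<- <-]; exists m => z zs.
  by have := vsP z zs; rewrite /avg_seq -foldl_cat -catA.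
pose Ls := fix Ls i := if i is i'.+1 then Ls i' ++ blk (i', Ls i') else [::].
have Ls1 i : unit_seq (Ls i).
  elim: i => [//|i IH] /=; rewrite /unit_seq all_cat.
  by have [h _ _] := blkP (i, Ls i) IH; apply/andP; split.
have Lsz i : (i <= size (Ls i))%N.
  elim: i => [//|i IH] /=; rewrite size_cat.
  by have [_ h _] := blkP (i, Ls i) (Ls1 i); rewrite -addn1 leq_add.
have Lpre i i' k : (i <= i')%N -> (k < size (Ls i))%N ->
    nth u0 (Ls i') k = nth u0 (Ls i) k.
  move=> ii' ki; rewrite -(subnK ii'); elim: (i' - i)%N => [//|j IH].
  rewrite addSn /= nth_cat IH ifT// (leq_trans ki)//.
  elim: (j) => [//|j' IH']; rewrite addSn /= size_cat.
  exact: leq_trans IH' (leq_addr _ _).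
(* [Ls k.+1] has more than [k] entries, so the default [u0] of [nth] never intervenes, and longer
   prefixes give the same entry. *)
pose u k := nth u0 (Ls k.+1) k.
have u1 k : usphere (u k).
  rewrite /usphere/=; apply/eqP; have /allP := Ls1 k.+1; apply.
  by apply: mem_nth; exact: Lsz.
have uL i k : (k < size (Ls i))%N -> u k = nth u0 (Ls i) k.
  move=> ki; have [ik|ki'] := leqP i k.+1; first exact: Lpre.
  by rewrite (Lpre k.+1 i)// ltnW.
exists u; split => // j e e0.
pose l := Num.truncn e^-1; pose i := pickle (j, l).
have [_ _ /(_ j l (pickleK _))] := blkP (i, Ls i) (Ls1 i).
case=> m mP; exists (size (Ls i.+1)) => // k /= ik; exists m.
have le : l.+1%:R^-1 <= e.
  rewrite -[leRHS]invrK lef_pV2 ?posrE ?invr_gt0// ltW//.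
  exact: Num.Theory.truncnS_gt.
have start : forall z, enorm z = sf j ->
    m <= avgs u (wf j) (size (Ls i.+1)) z <= m + e.
  move=> z zs; rewrite avgs_mkseq (_ : mkseq _ _ = Ls i.+1).
    by have /andP[-> h2] := mP z zs; rewrite (le_trans h2)// lerD2l.
  apply: (@eq_from_nth _ u0) => [|k']; rewrite size_mkseq// => k'i.
  by rewrite nth_mkseq// (uL i.+1).
rewrite -(subnK ik); elim: (k - _)%N => [//|k' IH]; rewrite addSn /=.
exact: avg_bounds.
Qed.

End Mixing.

(** * The Haar mean of a Lipschitz function *)

Lemma mulmx_continuous_l (R : realType) m n p (B : 'M[R]_(n, p)) :
  continuous (fun X : 'M[R]_(m, n) => X *m B).
Proof.
move=> M P /nbhs_ballP[e /= e0 MP].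
pose C : R := 1 + \sum_k \sum_j `|B k j|.
have C0 : 0 < C by rewrite ltr_wpDr// sumr_ge0// => k _; rewrite sumr_ge0.
apply/nbhs_ballP; exists (e / C) => /=; first by rewrite divr_gt0.
move=> N [_ MN]; apply: MP; split=> // i j; rewrite -ball_normE /= !mxE.
rewrite -sumrB; apply: le_lt_trans (ler_norm_sum _ _ _) _.
apply: (@le_lt_trans _ _ (\sum_k e / C * `|B k j|)).
  apply: ler_sum => k _; rewrite -mulrBl normrM ler_wpM2r// ltW//.
  by have := MN i k; rewrite -ball_normE.
rewrite -mulr_sumr mulrAC ltr_pdivrMr// ltr_pM2l// /C ltr_pwDl//.
apply: ler_sum => k _; rewrite (bigD1 j)//= lerDl.
by rewrite sumr_ge0.
Qed.

Lemma mulmx_continuous_r (R : realType) m n p (A : 'M[R]_(m, n)) :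
  continuous (fun X : 'M[R]_(n, p) => A *m X).
Proof.
rewrite (_ : mulmx A = trmx \o (fun X => X *m A^T) \o trmx); last first.
  by apply/funext => X /=; rewrite trmx_mul !trmxK.
move=> X; apply: continuous_comp; first exact: trmx_continuous.
apply: continuous_comp; [exact: mulmx_continuous_l|exact: trmx_continuous].
Qed.

(** * Borel measurability on the space of matrices *)

Section BorelMatrices.
Context {R : realType} {n : nat}.
Implicit Types (f : 'M[R]_n -> R) (w : 'cV[R]_n -> R).
Implicit Types (L : R).

Lemma continuous_measurable_mx f : continuous f ->
  measurable_fun [set: borel_mx R n] (f : borel_mx R n -> R).
Proof.
move=> /continuousP cf; apply: (measurability _ (RGenOpens.measurableE R)).
move=> _ [_ [a [b ->] <-]]; rewrite setTI; apply: sub_sigma_algebra.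
exact/cf/interval_open.
Qed.

Lemma continuous_measurable_mx_mx (f : 'M[R]_n -> 'M[R]_n) : continuous f ->
  measurable_fun [set: borel_mx R n] (f : borel_mx R n -> borel_mx R n).
Proof.
move=> /continuousP cf; apply: (@measurability _ _ _ (borel_mx R n) _ _ open) => //.
by move=> _ [B oB <-]; rewrite setTI; apply: sub_sigma_algebra; exact: cf.
Qed.

Lemma measurable_entry i j : measurable_fun [set: borel_mx R n]
  ((fun A : 'M[R]_n => A i j) : borel_mx R n -> R).
Proof. by apply: continuous_measurable_mx => A; exact: coord_continuous. Qed.

Lemma measurable_orthogonal_group :
  measurable (@orthogonal_group R n : set (borel_mx R n)).
Proof.
pose f (A : 'M[R]_n) := \sum_i \sum_j ((A *m A^T) i j - (i == j)%:R) ^+ 2.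
have mf : measurable_fun [set: borel_mx R n] (f : borel_mx R n -> R).
  apply: measurable_sum => i; apply: measurable_sum => j.
  apply: measurable_funX; apply: measurable_funB => //.
  under eq_fun do rewrite mxE.
  apply: measurable_sum => k; apply: measurable_funM; first exact: measurable_entry.
  by under eq_fun do rewrite mxE; exact: measurable_entry.
have := mf measurableT [set 0] (measurable_set1 0).
rewrite setTI; congr measurable; apply/seteqP; split=> A /=.
  move=> /eqP; rewrite psumr_eq0 => [/allP h|i _]; last by rewrite sumr_ge0// => j _; rewrite sqr_ge0.
  apply/matrixP => i j; rewrite [RHS]mxE.
  have := h i; rewrite mem_index_enum => /(_ isT).
  rewrite psumr_eq0 => [/allP/(_ j)|k _]; last by rewrite sqr_ge0.
  by rewrite mem_index_enum => /(_ isT); rewrite sqrf_eq0 subr_eq0 => /eqP.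
rewrite /orthogonal_group/= /f => ->; rewrite big1// => i _; rewrite big1// => j _.
by rewrite mxE subrr expr0n.
Qed.

Lemma lipschitz_mulmx_continuous L w y : elipschitz L w ->
  continuous (fun A : 'M[R]_n => w (A *m y)).
Proof.
move=> wL A; apply: (@continuous_comp 'M[R]_n 'cV[R]_n R (fun A => A *m y) w).
  exact: mulmx_continuous_l.
exact: (elipschitz_continuous wL).
Qed.

Lemma lipschitz_tr_mulmx_continuous L w y : elipschitz L w ->
  continuous (fun A : 'M[R]_n => w (A^T *m y)).
Proof.
move=> wL A; apply: (@continuous_comp 'M[R]_n 'M[R]_n R trmx (fun A : 'M[R]_n => w (A *m y))).
  exact: trmx_continuous.
exact: lipschitz_mulmx_continuous wL _.
Qed.

Definition dense_seq (k : nat) : 'cV[R]_n :=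
  if unpickle k is Some q then map_mx ratr (q : 'cV[rat]_n) else 0.

Lemma dense_seqP y e : 0 < e -> exists k, enorm (y - dense_seq k) < e.
Proof.
move=> e0; pose d := e / n.+1%:R.
have d0 : 0 < d by rewrite divr_gt0.
have /choice[q qP] : forall i, exists q : rat, `|y i 0 - ratr q| < d.
  move=> i; have [|q] := @rat_in_itvoo R (y i 0 - d) (y i 0 + d); first lra.
  rewrite in_itv/= => /andP[h1 h2]; exists q.
  by rewrite ltr_norml; apply/andP; split; lra.
exists (pickle (\col_i q i)); rewrite /dense_seq pickleK.
apply: le_lt_trans (enorm_le_norm _) _; rewrite mulrC -ltr_pdivlMr//.
rewrite [ltLHS]/Num.norm/= mx_normrE; apply/bigmax_ltP; split => // -[i j] _ /=.
by rewrite (ord1 j) !mxE.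
Qed.

(* A countable infimum of cones: this gives the joint measurability needed for
   Fubini without comparing Borel sigma-algebras of products. *)
Lemma lipschitz_infsE L w y : 0 <= L -> elipschitz L w ->
  w y = infs (fun k => w (dense_seq k) + L * enorm (y - dense_seq k)) 0.
Proof.
move=> L0 wL; rewrite /infs/=.
have lb : lbound (sdrop (fun k => w (dense_seq k) + L * enorm (y - dense_seq k)) 0) (w y).
  by move=> _ [k _ <-] /=; exact: elipschitz_ub.
apply/eqP; rewrite eq_le; apply/andP; split.
  by apply: lb_le_inf => //; eexists; exists 0%N.
apply/ler_addgt0Pr => e e0.
have [|k ky] := @dense_seqP y (e / (2 * (L + 1))).
  by rewrite divr_gt0// mulr_gt0//; lra.
apply: (@le_trans _ _ (w (dense_seq k) + L * enorm (y - dense_seq k))).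
  by apply: ge_inf; [exists (w y)|exists k].
have := elipschitz_ub (dense_seq k) y wL; rewrite enormB.
have : (L + 1) * enorm (y - dense_seq k) <= e / 2.
  move: ky; rewrite ltr_pdivlMr ?mulr_gt0//; first lra.
  by have := enorm_ge0 y; lra.
by have := enorm_ge0 (y - dense_seq k); lra.
Qed.

Lemma measurable_lipschitz_tr_mul L w y : 0 <= L -> elipschitz L w ->
  measurable_fun [set: borel_mx R n * borel_mx R n]
    (fun p : borel_mx R n * borel_mx R n =>
      w ((p.1 : 'M[R]_n)^T *m ((p.2 : 'M[R]_n) *m y))).
Proof.
move=> L0 wL; under eq_fun do rewrite (lipschitz_infsE _ L0 wL).
apply: measurable_fun_infs => [[A B] _ /=|k].
  exists (w (A^T *m (B *m y))) => _ [k _ <-].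
  exact: elipschitz_ub.
apply: measurable_funD => //; apply: measurable_funM => //.
apply: (measurableT_comp (continuous_measurable_fun (@sqrt_continuous R))).
apply: measurable_sum => i.
have m1 : measurable_fun [set: borel_mx R n * borel_mx R n]
    (fun p : borel_mx R n * borel_mx R n =>
       ((p.1 : 'M[R]_n)^T *m ((p.2 : 'M[R]_n) *m y) - dense_seq k) i 0).
  under eq_fun do rewrite mxE; apply: measurable_funD; last first.
    exact: measurable_cst.
  under eq_fun do rewrite mxE; apply: measurable_sum => j.
  apply: measurable_funM.
    under eq_fun do rewrite mxE.
    exact: (measurableT_comp (measurable_entry j i) measurable_fst).
  under eq_fun do rewrite mxE; apply: measurable_sum => l.
  apply: measurable_funM => //.
  exact: (measurableT_comp (measurable_entry j l) measurable_snd).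
exact: measurable_funM.
Qed.

End BorelMatrices.

Section LipschitzOps.
Context {R : realType} {n : nat}.
Implicit Types (w : 'cV[R]_n -> R) (L : R).

Lemma elipschitzDr L w c : elipschitz L w -> elipschitz L (fun z => w z + c).
Proof. by move=> wL a b; rewrite opprD addrACA subrr addr0; exact: wL. Qed.

Lemma elipschitzZ L w k : elipschitz L w -> elipschitz (`|k| * L) (fun z => k * w z).
Proof. by move=> wL a b; rewrite -mulrBr normrM -mulrA ler_wpM2l. Qed.

Lemma elipschitzD L L' w w' : elipschitz L w -> elipschitz L' w' ->
  elipschitz (L + L') (fun z => w z + w' z).
Proof.
move=> wL wL' a b; rewrite opprD addrACA mulrDl.
by apply: le_trans (ler_normD _ _) _; rewrite lerD.
Qed.

End LipschitzOps.

(** * Invariance of Haar means under reflection averages *)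

Section HaarMean.
Context {R : realType} {n : nat}.
Variables (eta : probability (borel_mx R n) R) (eta_haar : is_haar eta).
Implicit Types (w : 'cV[R]_n -> R) (x y z u : 'cV[R]_n) (L m M : R).

Local Notation O := (@orthogonal_group R n : set (borel_mx R n)).

Let mO : measurable O := measurable_orthogonal_group.

Let etaO : eta O = 1%E. Proof. exact: eta_haar.1. Qed.

Lemma ge0_integral_orthogonal (F : borel_mx R n -> \bar R) :
  measurable_fun [set: borel_mx R n] F -> (forall A, (0 <= F A)%E) ->
  (\int[eta]_A F A = \int[eta]_(A in O) F A)%E.
Proof.
move=> mF F0; rewrite (@ge0_negligible_integral _ _ _ eta setT (~` O))//.
- by rewrite setTD setCK.
- exact: measurableC.
- by have := probability_setC eta mO; rewrite etaO subee.
Qed.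

Lemma haar_left_invariant (A : 'M[R]_n) (F : borel_mx R n -> \bar R) :
  orthogonal_group A -> measurable_fun [set: borel_mx R n] F ->
  (forall B, (0 <= F B)%E) ->
  (\int[eta]_B F (A *m B : 'M[R]_n) = \int[eta]_B F B)%E.
Proof.
move=> OA mF F0.
have mA : measurable_fun [set: borel_mx R n]
    ((fun B : 'M[R]_n => A *m B) : borel_mx R n -> borel_mx R n).
  apply: continuous_measurable_mx_mx; exact: mulmx_continuous_r.
have := @ge0_integral_pushforward _ _ _ _ R _ mA eta setT F measurableT mF.
rewrite preimage_setT => <-; last by [].
apply: eq_measure_integral => B mB _; rewrite /pushforward.
exact: eta_haar.2.
Qed.

(* Fubini applied to [w (A^T B y)], together with left invariance in each
   variable, replaces the missing right invariance of the Haar measure. *)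
Lemma haar_integral_mul_tr L w y : 0 <= L -> elipschitz L w ->
  (forall z, 0 <= w z) ->
  (\int[eta]_(A in O) (w ((A : 'M[R]_n)^T *m y))%:E =
   \int[eta]_(A in O) (w ((A : 'M[R]_n) *m y))%:E)%E.
Proof.
move=> L0 wL w0.
pose F (p : borel_mx R n * borel_mx R n) : \bar R :=
  (w ((p.1 : 'M[R]_n)^T *m ((p.2 : 'M[R]_n) *m y)))%:E.
have mF : measurable_fun [set: borel_mx R n * borel_mx R n] F.
  by apply/measurable_EFinP; exact: measurable_lipschitz_tr_mul L0 wL.
have F0 p : (0 <= F p)%E by rewrite lee_fin.
have w0E z : (0 <= (w z)%:E)%E by rewrite lee_fin.
have mtr z : measurable_fun [set: borel_mx R n]
    (fun A : borel_mx R n => (w ((A : 'M[R]_n)^T *m z))%:E).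
  apply/measurable_EFinP; apply: continuous_measurable_mx.
  exact: lipschitz_tr_mulmx_continuous wL.
have mmul z : measurable_fun [set: borel_mx R n]
    (fun A : borel_mx R n => (w ((A : 'M[R]_n) *m z))%:E).
  apply/measurable_EFinP; apply: continuous_measurable_mx.
  exact: lipschitz_mulmx_continuous wL.
have := fubini_tonelli (m1 := eta) (m2 := eta) F mF F0.
rewrite ge0_integral_orthogonal; last 2 first.
- exact: measurable_fun_fubini_tonelli_F.
- by move=> A; exact: integral_ge0.
rewrite [RHS]ge0_integral_orthogonal; last 2 first.
- exact: measurable_fun_fubini_tonelli_G.
- by move=> A; exact: integral_ge0.
have intO (r : \bar R) : (\int[eta]_(A in O) r = r)%E.
  transitivity (r * 1)%E; last by rewrite mule1.
  by rewrite integral_cst//; congr (_ * _)%E; exact: etaO.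
rewrite (eq_integral (fun=> \int[eta]_(A in O) (w ((A : 'M[R]_n) *m y))%:E)%E); last first.
  move=> A /[!inE] OA; rewrite -ge0_integral_orthogonal//.
  rewrite -[RHS](haar_left_invariant (orthogonal_tr OA))//.
  by apply: eq_integral => B _; rewrite /F/= mulmxA.
(* With the second variable [B] of [F] fixed, [w (A^T B y) = w ((B^T A)^T y)], so invariance under
   left multiplication by [B^T] applies. *)
rewrite intO [RHS](eq_integral
    (fun=> \int[eta]_(A in O) (w ((A : 'M[R]_n)^T *m y))%:E)%E).
  by rewrite intO.
move=> A /[!inE] OA; rewrite -ge0_integral_orthogonal//.
rewrite -[RHS](haar_left_invariant (orthogonal_tr OA))//.
by apply: eq_integral => B _; rewrite /F/= trmx_mul trmxK mulmxA.
Qed.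

(** On O(n) the transpose is the inverse that occurs in [is_psi_sym]; being continuous on all
    matrices, it makes measurability immediate. *)
Definition haar_mean w y : R := \int[eta]_(A in O) w ((A : 'M[R]_n)^T *m y).

Lemma elipschitz_bound L w z : elipschitz L w -> `|w z| <= `|w 0| + L * enorm z.
Proof.
move=> wL; have := elipschitz_ub z 0 wL; have := elipschitz_ub 0 z wL.
rewrite subr0 sub0r enormN => h1 h2; rewrite ler_norml.
have := ler_norm (w 0); have := ler_norm (- w 0); rewrite normrN.
by move=> h3 h4; apply/andP; split; lra.
Qed.

Lemma haar_mean_integrable L w y : elipschitz L w ->
  eta.-integrable O (EFin \o (fun A : borel_mx R n => w ((A : 'M[R]_n)^T *m y))).
Proof.
move=> wL; apply: measurable_bounded_integrable => //.
- by have := ltry (1 : R); rewrite -etaO.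
- apply: measurable_funTS; apply: continuous_measurable_mx.
  exact: lipschitz_tr_mulmx_continuous wL.
- exists (`|w 0| + L * enorm y); split; first exact: num_real.
  move=> M wM A OA /=; apply: le_trans (ltW wM).
  by rewrite -(enorm_orthogonal y (orthogonal_tr OA)) elipschitz_bound.
Qed.

Lemma haar_meanE L w y : elipschitz L w ->
  ((haar_mean w y)%:E = \int[eta]_(A in O) (w ((A : 'M[R]_n)^T *m y))%:E)%E.
Proof.
by move=> wL; rewrite /haar_mean fineK//; apply: integrable_fin_num => //;
  exact: haar_mean_integrable wL.
Qed.

Lemma haar_cst m : \int[eta]_(A in O) m = m.
Proof.
transitivity (m * 1); last by rewrite mulr1.
by rewrite Rintegral_cst//; congr (_ * _); exact: (congr1 fine etaO).
Qed.

Lemma integrable_haar_cst m : eta.-integrable O (EFin \o cst m).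
Proof.
by apply: finite_measure_integrable_cst.
Qed.

Lemma haar_mean_bounds L w y m M : elipschitz L w ->
  (forall z, enorm z = enorm y -> m <= w z <= M) -> m <= haar_mean w y <= M.
Proof.
move=> wL wmM; have iw := haar_mean_integrable y wL.
have b A : O A -> m <= w ((A : 'M[R]_n)^T *m y) <= M.
  by move=> OA; apply: wmM; rewrite enorm_orthogonal//; exact: orthogonal_tr.
apply/andP; split.
  rewrite -[leLHS]haar_cst; apply: le_Rintegral => //.
    exact: integrable_haar_cst.
  by move=> A /b/andP[].
rewrite -[leRHS]haar_cst; apply: le_Rintegral => //.
  exact: integrable_haar_cst.
by move=> A /b/andP[].
Qed.

Lemma haar_mean_lipschitz L w : elipschitz L w -> elipschitz L (haar_mean w).
Proof.
move=> wL.
have ub x y : haar_mean w x <= haar_mean w y + L * enorm (x - y).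
  rewrite -[X in _ + X]haar_cst -RintegralD//; last 2 first.
  - exact: haar_mean_integrable wL.
  - exact: integrable_haar_cst.
  apply: le_Rintegral => //.
  - exact: haar_mean_integrable wL.
  - exact: (haar_mean_integrable y (elipschitzDr (L * enorm (x - y)) wL)).
  move=> A OA; apply: le_trans (elipschitz_ub _ ((A : 'M[R]_n)^T *m y) wL) _.
  by rewrite -mulmxBr enorm_orthogonal//; exact: orthogonal_tr.
move=> x y; have := ub x y; have := ub y x; rewrite (enormB y) ler_norml.
by move=> h1 h2; apply/andP; split; lra.
Qed.

Lemma haar_mean_convex L w x y (l : R) : elipschitz L w ->
  (forall a b, w (l *: a + (1 - l) *: b) <= l * w a + (1 - l) * w b) ->
  haar_mean w (l *: x + (1 - l) *: y) <= l * haar_mean w x + (1 - l) * haar_mean w y.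
Proof.
move=> wL wc; have iw z := haar_mean_integrable z wL.
have iZ (k : R) z : eta.-integrable O
    (EFin \o (fun A : borel_mx R n => k * w ((A : 'M[R]_n)^T *m z))).
  exact: (haar_mean_integrable z (elipschitzZ k wL)).
have iD : eta.-integrable O (EFin \o (fun A : borel_mx R n =>
    l * w ((A : 'M[R]_n)^T *m x) + (1 - l) * w ((A : 'M[R]_n)^T *m y))).
  apply: eq_integrable (integrableD mO (iZ l x) (iZ (1 - l) y)) => //.
rewrite -!RintegralZl// -RintegralD//; apply: le_Rintegral => //.
by move=> A OA; rewrite mulmxDr -!scalemxAr.
Qed.

Lemma le_haar_mean L L' w w' y : elipschitz L w -> elipschitz L' w' ->
  (forall z, enorm z = enorm y -> w z <= w' z) -> haar_mean w y <= haar_mean w' y.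
Proof.
move=> wL wL' ww'; apply: le_Rintegral => //.
- exact: haar_mean_integrable wL.
- exact: haar_mean_integrable wL'.
- by move=> A OA; apply: ww'; rewrite enorm_orthogonal//; exact: orthogonal_tr.
Qed.

Lemma eq_haar_mean L L' w w' y : elipschitz L w -> elipschitz L' w' ->
  (forall z, enorm z = enorm y -> w z = w' z) -> haar_mean w y = haar_mean w' y.
Proof.
move=> wL wL' ww'; apply/eqP; rewrite eq_le; apply/andP; split.
  by apply: (le_haar_mean wL wL') => z /ww'->.
by apply: (le_haar_mean wL' wL) => z /ww'->.
Qed.

(** As [R_u A^T = (A R_u)^T], the reflection acts by a right translation of [A]. Exchanging [A^T]
    for [A] under the integral turns it into a left translation. *)
Lemma haar_mean_reflection_ge0 L w u y : 0 <= L -> elipschitz L w ->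
  (forall z, 0 <= w z) -> usphere u ->
  haar_mean (w \o reflection u) y = haar_mean w y.
Proof.
move=> L0 wL w0 u1.
have wL' : elipschitz L (w \o reflection u).
  by move=> a b /=; rewrite -(enorm_reflectionB a b u1); exact: wL.
have w0E z : (0 <= (w z)%:E)%E by rewrite lee_fin.
have mmul : measurable_fun [set: borel_mx R n]
    (fun A : borel_mx R n => (w ((A : 'M[R]_n) *m y))%:E).
  apply/measurable_EFinP; apply: continuous_measurable_mx.
  exact: lipschitz_mulmx_continuous wL.
apply/eqP; rewrite -eqe; apply/eqP; rewrite (haar_meanE _ wL) (haar_meanE _ wL').
rewrite (haar_integral_mul_tr _ L0 wL')//; last by move=> z; exact: w0.
rewrite (haar_integral_mul_tr _ L0 wL)// -[RHS]ge0_integral_orthogonal//.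
rewrite -(haar_left_invariant (orthogonal_reflection_mx u1))//.
rewrite ge0_integral_orthogonal.
- by apply: eq_integral => A _; rewrite -mulmxA reflection_mxE.
- apply/measurable_EFinP; apply: continuous_measurable_mx.
  under eq_fun do rewrite -mulmxA reflection_mxE.
  exact: (@lipschitz_mulmx_continuous _ _ L (w \o reflection u) y wL').
- by [].
Qed.

Lemma haar_mean_avg L w u y : 0 <= L -> elipschitz L w -> usphere u ->
  haar_mean (avg u w) y = haar_mean w y.
Proof.
(* The invariance under reflections is at hand for nonnegative functions. [w + C] is nonnegative on
   the sphere through [y], the only set that the mean sees; the absolute value extends this to all
   points and keeps the constant [L]. *)
move=> L0 wL u1; pose C := `|w 0| + L * enorm y.
pose g z := `|w z + C|.
have gL : elipschitz L g.
  move=> a b; apply: le_trans (ler_dist_dist _ _) _.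
  by rewrite opprD addrACA subrr addr0; exact: wL.
have gL' : elipschitz L (g \o reflection u).
  by move=> a b /=; rewrite -(enorm_reflectionB a b u1); exact: gL.
have aL := avg_lipschitz u1 wL.
have gE z : enorm z = enorm y -> g z = w z + C.
  move=> zy; have := elipschitz_bound z wL; rewrite zy -/C ler_norml => /andP[h _].
  by rewrite /g ger0_norm//; lra.
have mean w1 : elipschitz L w1 ->
    haar_mean (fun z => w1 z + C) y = haar_mean w1 y + C.
  move=> w1L; rewrite /haar_mean RintegralD ?haar_cst//.
    exact: haar_mean_integrable w1L.
  exact: integrable_haar_cst.
have CL w1 : elipschitz L w1 -> elipschitz L (fun z => w1 z + C).
  exact: elipschitzDr.
apply: (addIr C); rewrite -mean// -[RHS]mean//.
rewrite -(eq_haar_mean gL (CL _ wL)) //.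
rewrite (eq_haar_mean (CL _ aL) (avg_lipschitz u1 gL)); last first.
  move=> z zy; rewrite /avg !gE ?enorm_reflection//; lra.
rewrite {1}/haar_mean /avg.
have iw := haar_mean_integrable y gL; have iw' := haar_mean_integrable y gL'.
rewrite RintegralZr//; last first.
  by have := haar_mean_integrable y (elipschitzD gL gL').
rewrite RintegralD// -/(haar_mean g y).
rewrite -[X in _ + X]/(haar_mean (g \o reflection u) y).
rewrite (haar_mean_reflection_ge0 _ L0 gL)//; last first.
  by move=> z; rewrite normr_ge0.
by lra.
Qed.

Lemma haar_mean_avg_seq L w (us : seq 'cV[R]_n) y : 0 <= L -> elipschitz L w ->
  unit_seq us -> haar_mean (avg_seq us w) y = haar_mean w y.
Proof.
move=> L0; elim: us w => [//|u us IH] w wL /= /andP[/eqP u1 us1].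
by rewrite IH//; [exact: haar_mean_avg wL _|exact: avg_lipschitz].
Qed.

Lemma haar_mean_avgs L w (u : nat -> 'cV[R]_n) k y : 0 <= L -> elipschitz L w ->
  (forall j, usphere (u j)) -> haar_mean (avgs u w k) y = haar_mean w y.
Proof.
move=> L0 wL u1; rewrite avgs_mkseq (haar_mean_avg_seq _ L0 wL)//.
by apply/allP => _ /mapP[j _ ->]; apply/eqP/u1.
Qed.

End HaarMean.

(** * The Haar mean of a Legendre transform *)

Section ExtendedIntegral.
Context d (T : measurableType d) (R : realType) (mu : {measure set T -> \bar R}).
Variables (D : set T) (mD : measurable D) (h : T -> \bar R) (C : R).
Hypotheses (mu1 : mu D = 1%E) (mh : measurable_fun D h) (C0 : 0 <= C)
  (hC : forall x, D x -> ((- C)%:E <= h x)%E).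
Local Open Scope ereal_scope.

(** [h] may fail to be integrable. Its negative part has a finite integral, and
    [h^+ + C = (h + C) + h^-] is an identity between nonnegative functions, for which additivity
    holds. *)
Lemma integral_shift :
  \int[mu]_(x in D) h x = \int[mu]_(x in D) (h x + C%:E) - C%:E.
Proof.
have intC : \int[mu]_(x in D) C%:E = C%:E by rewrite integral_cst// mu1 mule1.
have hD0 x : D x -> 0 <= h x + C%:E.
  by move=> /hC; rewrite -leeBlDr// add0e EFinN.
have mhC : measurable_fun D (fun x => h x + C%:E) by exact: emeasurable_funD.
have neg_le x : D x -> h^\- x <= C%:E.
  by move=> /hC hx; rewrite funenegE ge_max lee_fin C0 andbT leeNl -EFinN.
have neg_fin : \int[mu]_(x in D) h^\- x \is a fin_num.
  rewrite ge0_fin_numE; last by apply: integral_ge0.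
  apply: le_lt_trans (ltry C); rewrite -[leRHS]intC.
  apply: ge0_le_integral => //; exact: measurable_funeneg.
have eqp : \int[mu]_(x in D) h^\+ x + C%:E =
    \int[mu]_(x in D) (h x + C%:E) + \int[mu]_(x in D) h^\- x.
  rewrite -{1}intC -!ge0_integralD//; last 2 first.
  - exact: measurable_funeneg.
  - exact: measurable_funepos.
  apply: eq_integral => x; rewrite inE => /hC; rewrite funeposE funenegE.
  case: (h x) => [r _| _|//].
  - rewrite -EFinN -!EFin_max -!EFinD; congr EFin.
    by case: (leP r 0%R) => r0; [rewrite max_l ?oppr_ge0//|rewrite max_r ?oppr_le0 1?ltW//]; lra.
  - by rewrite /maxe/= !ltNye /= addye.
rewrite integralE -[X in X - _](addeK (x := C%:E))// eqp.
by rewrite addeAC addeK.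
Qed.

End ExtendedIntegral.

Lemma at_infty_filter (R : realType) (n : nat) : Filter (@at_infty R n).
Proof.
apply: filter_from_filter; first by exists 0.
move=> r s _ _; exists (Num.max r s) => // x /=.
by rewrite gt_max => /andP[].
Qed.

Section MeanLegendre.
Context {R : realType} {n : nat} (n_gt0 : (0 < n)%N).
Variables (eta : probability (borel_mx R n) R) (eta_haar : is_haar eta).
Variables (psi : 'cV[R]_n -> \bar R) (a b m : R) (x0 : 'cV[R]_n) (v0 : R).
Hypotheses (a_gt0 : 0 < a) (psi_growth : linear_growth a b psi).
Hypotheses (psi_ge : forall x, (m%:E <= psi x)%E) (psi_x0 : (psi x0 <= v0%:E)%E).
Implicit Types (x y z : 'cV[R]_n) (N M : nat) (c s t : R).

Local Notation O := (@orthogonal_group R n : set (borel_mx R n)).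

Let mO : measurable O := measurable_orthogonal_group.
Let etaO : eta O = 1%E. Proof. exact: eta_haar.1. Qed.

Definition trunc_radius N : R := enorm x0 + N%:R.

Lemma trunc_radius_ge N : enorm x0 <= trunc_radius N.
Proof. by rewrite lerDl. Qed.

Lemma trunc_radius_ge0 N : 0 <= trunc_radius N.
Proof. by rewrite addr_ge0. Qed.

Definition truncated N : 'cV[R]_n -> R := trunc_legendre psi (trunc_radius N).

Lemma truncated_ub N y x v : enorm x <= trunc_radius N -> (psi x <= v%:E)%E ->
  inner y x - v <= truncated N y.
Proof. exact: (trunc_legendre_ub psi_ge psi_x0 (trunc_radius_ge N)). Qed.

Lemma truncated_lipschitz N : elipschitz (trunc_radius N) (truncated N).
Proof. exact: (trunc_legendre_lipschitz psi_ge psi_x0 (trunc_radius_ge N)). Qed.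

Lemma truncated_le_legendre N y : ((truncated N y)%:E <= legendre psi y)%E.
Proof. exact: (trunc_legendre_le_legendre psi_ge psi_x0 (trunc_radius_ge N)). Qed.

Lemma truncated_leP N y c :
  (forall x v, enorm x <= trunc_radius N -> (psi x <= v%:E)%E -> inner y x - v <= c) ->
  truncated N y <= c.
Proof. exact: (trunc_legendre_le psi_ge psi_x0 (trunc_radius_ge N)). Qed.

Lemma truncated_mono N M y : (N <= M)%N -> truncated N y <= truncated M y.
Proof.
move=> NM; apply: truncated_leP => x v xN; apply: truncated_ub.
by rewrite (le_trans xN)// lerD2l ler_nat.
Qed.

(** A bound uniform in [N] and constant on spheres, obtained from the single point [x0]; it supplies
    the shift that makes all truncations nonnegative on a sphere. *)
Lemma truncated_ge N y : - (enorm y * enorm x0 + `|v0|) <= truncated N y.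
Proof.
have := @truncated_ub N y x0 v0 (trunc_radius_ge N) psi_x0.
have := cauchy_schwarz (- y) x0; rewrite enormN innerNl.
have := ler_norm v0; lra.
Qed.

Lemma truncated_sup y C : ereal_sup (range (fun N => (truncated N y + C)%:E)) =
  (legendre psi y + C%:E)%E.
Proof.
apply/eqP; rewrite eq_le; apply/andP; split.
  apply: ge_ereal_sup => _ [N _ <-]; rewrite EFinD leeD2r//.
  exact: truncated_le_legendre.
rewrite -leeBrDr//; apply: ge_ereal_sup => _ [x _ <-]; rewrite leeBrDr//.
case E : (psi x) (psi_ge x) => [r| |]// _; last by rewrite addeNy addNye leNye.
pose N := (Num.truncn (enorm x)).+1.
apply: (@le_trans _ _ (truncated N y + C)%:E); last first.
  by apply: ereal_sup_ubound; exists N.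
rewrite -EFinB -EFinD lee_fin lerD2r; apply: truncated_ub; last by rewrite E.
have := Num.Theory.truncnS_gt (enorm x); rewrite -/N /trunc_radius => h.
by have := enorm_ge0 x0; lra.
Qed.

Definition mean_legendre y : \bar R :=
  (\int[eta]_(theta in O) legendre psi (invmx (theta : 'M[R]_n) *m y))%E.

Let mean_trunc N y := haar_mean eta (truncated N) y.

(** Monotone convergence for the truncations shifted by [C]; [integral_shift] removes the shift even
    where the mean is [+oo]. *)
Let mean_legendreE y (C := enorm y * enorm x0 + `|v0|) :
  mean_legendre y =
  (ereal_sup (range (fun N => (mean_trunc N y + C)%:E)) - C%:E)%E.
Proof.
have C0 : 0 <= C by rewrite addr_ge0// mulr_ge0.
pose g N (A : borel_mx R n) := (truncated N ((A : 'M[R]_n)^T *m y) + C)%:E.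
have gL N : elipschitz (trunc_radius N) (fun z => truncated N z + C).
  exact/elipschitzDr/truncated_lipschitz.
have mg N : measurable_fun O (g N).
  apply: measurable_funTS; apply/measurable_EFinP; apply: continuous_measurable_mx.
  exact: lipschitz_tr_mulmx_continuous (gL N).
have nd A : {homo g^~ A : N M / (N <= M)%N >-> (N <= M)%E}.
  by move=> N M NM; rewrite lee_fin lerD2r truncated_mono.
have limg A : limn (g^~ A) = (legendre psi ((A : 'M[R]_n)^T *m y) + C%:E)%E.
  rewrite -truncated_sup; apply/cvg_lim => //.
  exact: ereal_nondecreasing_cvgn.
have g0 N A : O A -> (0 <= g N A)%E.
  move=> OA; rewrite lee_fin /C -(enorm_orthogonal y (orthogonal_tr OA)).
  by have := truncated_ge N ((A : 'M[R]_n)^T *m y); lra.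
transitivity (\int[eta]_(A in O) legendre psi ((A : 'M[R]_n)^T *m y))%E.
  by apply: eq_integral => A; rewrite inE => OA; rewrite orthogonal_invmx.
rewrite (integral_shift (C := C) mO)//; last 2 first.
- apply: (emeasurable_fun_cvg (fun N (A : borel_mx R n) =>
    (truncated N ((A : 'M[R]_n)^T *m y))%:E)) => [N|A _].
    apply: measurable_funTS; apply/measurable_EFinP; apply: continuous_measurable_mx.
    exact: lipschitz_tr_mulmx_continuous (truncated_lipschitz N).
  have := truncated_sup ((A : 'M[R]_n)^T *m y) 0; rewrite adde0 => <-.
  rewrite (_ : (fun N => _) = fun N => (truncated N ((A : 'M[R]_n)^T *m y) + 0)%:E).
    apply: ereal_nondecreasing_cvgn => N M NM.
    by rewrite lee_fin lerD2r truncated_mono.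
  by apply/funext => N; rewrite addr0.
- move=> A OA; apply: le_trans (truncated_le_legendre 0 _).
  rewrite lee_fin /C -(enorm_orthogonal y (orthogonal_tr OA)).
  exact: truncated_ge.
congr (_ - _)%E.
under eq_integral do rewrite -limg.
rewrite monotone_convergence//.
have -> : (fun N => \int[eta]_(A in O) g N A)%E = (fun N => (mean_trunc N y + C)%:E).
  apply/funext => N; rewrite /g -(haar_meanE eta_haar y (gL N)); congr EFin.
  rewrite /haar_mean RintegralD//; last 2 first.
  - exact: haar_mean_integrable (truncated_lipschitz N).
  - exact: integrable_haar_cst.
  by rewrite haar_cst.
apply/cvg_lim => //; apply: ereal_nondecreasing_cvgn => N M NM.
rewrite lee_fin lerD2r; apply: le_haar_mean => [|||z _] //.
- exact: truncated_lipschitz.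
- exact: truncated_lipschitz.
- exact: truncated_mono.
Qed.

Lemma mean_truncated_le N y :
  ((haar_mean eta (truncated N) y)%:E <= mean_legendre y)%E.
Proof.
rewrite mean_legendreE leeBrDr// -EFinD.
by apply: ereal_sup_ubound; exists N.
Qed.

Lemma mean_legendre_le y c :
  (forall N, haar_mean eta (truncated N) y <= c) -> (mean_legendre y <= c%:E)%E.
Proof.
move=> h; rewrite mean_legendreE leeBlDr// -EFinD.
by apply: ge_ereal_sup => _ [N _ <-]; rewrite lee_fin lerD2r; exact: h.
Qed.

Lemma mean_legendre_gt y c : (c%:E < mean_legendre y)%E ->
  exists N, c < haar_mean eta (truncated N) y.
Proof.
move=> h; apply: contrapT => h'; move: h; apply/negP; rewrite -leNgt.
apply: mean_legendre_le => N; rewrite leNgt; apply/negP => cN.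
by apply: h'; exists N.
Qed.

(** Mixing replaces right invariance: averages leave the mean unchanged and make [w] constant on the
    sphere up to [e], so the two means differ by at most [e]. *)
Lemma haar_mean_radial (L : R) w y z : 0 <= L -> elipschitz L w ->
  enorm y = enorm z -> haar_mean eta w y = haar_mean eta w z.
Proof.
move=> L0 wL.
have le y' z' : enorm y' = enorm z' -> haar_mean eta w y' <= haar_mean eta w z'.
  move=> yz; apply/ler_addgt0Pr => e e0.
  have [us [c [us1 usP]]] := osc_reduction n_gt0 (enorm_ge0 z') L0 e0 wL.
  have uL := avg_seq_lipschitz us1 wL.
  have /andP[_ h1] : c <= haar_mean eta (avg_seq us w) y' <= c + e.
    by apply: haar_mean_bounds uL _ => // x; rewrite yz; exact: usP.
  have /andP[h2 _] : c <= haar_mean eta (avg_seq us w) z' <= c + e.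
    by apply: haar_mean_bounds uL _ => // x; exact: usP.
  by move: h1 h2; rewrite !(haar_mean_avg_seq eta_haar _ L0 wL us1); lra.
by move=> yz; apply/eqP; rewrite eq_le !le.
Qed.

Lemma mean_legendre_radial : radial mean_legendre.
Proof.
have le A y : orthogonal_group A -> (mean_legendre (A *m y) <= mean_legendre y)%E.
  move=> OA; rewrite leNgt; apply/negP.
  case E : (mean_legendre y) (mean_truncated_le 0 y) => [r| |]// _.
    move=> /mean_legendre_gt[N]; rewrite ltNge => /negP; apply.
    have := mean_truncated_le N y; rewrite E lee_fin.
    rewrite (@haar_mean_radial _ _ _ (A *m y) (trunc_radius_ge0 N))//.
      exact: truncated_lipschitz.
    by rewrite enorm_orthogonal.
  by rewrite ltNge leey.
move=> A OA y; apply/eqP; rewrite eq_le; apply/andP; split; first exact: le.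
have {1}-> : y = A^T *m (A *m y) by rewrite mulmxA orthogonal_trmx_mul// mul1mx.
by apply: le; exact: orthogonal_tr.
Qed.

Lemma mean_legendre_convex : epi_convex mean_legendre.
Proof.
move=> x y c d l xc yd l01; apply: mean_legendre_le => N.
have := haar_mean_convex eta_haar x y (l := l) (truncated_lipschitz N).
move=> /(_ _)/le_trans; apply.
  move=> z z'.
  exact: (trunc_legendre_convex psi_ge psi_x0 (trunc_radius_ge N)).
have := mean_truncated_le N x; have := mean_truncated_le N y.
move=> /le_trans/(_ yd); rewrite lee_fin => h1 /le_trans/(_ xc); rewrite lee_fin => h2.
by case/andP: l01 => l0 l1; rewrite lerD// ler_wpM2l//; lra.
Qed.

Lemma mean_legendre_lsc : lower_semicontinuous mean_legendre.
Proof.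
move=> y c /mean_legendre_gt[N cN].
have hL := haar_mean_lipschitz eta_haar (truncated_lipschitz N).
have d0 : 0 < haar_mean eta (truncated N) y - c by lra.
exists [set z | `|haar_mean eta (truncated N) z - haar_mean eta (truncated N) y| <
  haar_mean eta (truncated N) y - c]; first exact: near_elipschitz hL d0.
move=> z /=; rewrite ltr_norml => /andP[h _].
apply: lt_le_trans (mean_truncated_le N z); rewrite lte_fin; lra.
Qed.

(** A radial convex function takes equal values at [y] and [- y] and is therefore minimal at 0,
    where the point [x0] bounds the truncation from below by [- v0]. *)
Lemma mean_legendre_ge y : ((- v0)%:E <= mean_legendre y)%E.
Proof.
apply: le_trans (mean_truncated_le 0 y); rewrite lee_fin.
have tL := truncated_lipschitz 0.
have := haar_mean_convex eta_haar y (- y) (l := 2^-1) tL.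
move=> /(_ _); rewrite (_ : 2^-1 *: y + (1 - 2^-1) *: - y = 0); last first.
  by apply/colP => i; rewrite !mxE; field.
rewrite (@haar_mean_radial _ _ (- y) y (trunc_radius_ge0 0) tL) ?enormN// => h.
have /andP[h0 _] : - v0 <= haar_mean eta (truncated 0) 0 <= truncated 0 0.
  apply: (haar_mean_bounds eta_haar tL) => z; rewrite enorm0 => /enorm_eq0 ->.
  rewrite lexx andbT; have := @truncated_ub 0 0 x0 v0 (trunc_radius_ge 0) psi_x0.
  by rewrite inner0l; lra.
apply: le_trans h0 (le_trans (h _) _) => [z z'|].
  apply: (trunc_legendre_convex psi_ge psi_x0 (trunc_radius_ge 0)); lra.
by rewrite -mulrDl addrC subrK mul1r.
Qed.

Lemma mean_legendre0 : (mean_legendre 0 <= (- m)%:E)%E.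
Proof.
apply: mean_legendre_le => N.
have /andP[_ //] : truncated N 0 <= haar_mean eta (truncated N) 0 <= - m.
apply: (haar_mean_bounds eta_haar (truncated_lipschitz N)) => z.
rewrite enorm0 => /enorm_eq0 ->; rewrite lexx/=; apply: truncated_leP => x v _ xv.
by rewrite inner0l sub0r lerN2 -lee_fin (le_trans (psi_ge x)).
Qed.

(** The dual form of linear growth; conjugating back gives [psi_sym] the growth of [psi]. *)
Lemma mean_legendre_ball y : enorm y <= a -> (mean_legendre y <= (- b)%:E)%E.
Proof.
move=> ya; apply: mean_legendre_le => N.
have /andP[_ //] : - (enorm y * enorm x0 + `|v0|) <= haar_mean eta (truncated N) y <= - b.
apply: (haar_mean_bounds eta_haar (truncated_lipschitz N)) => z zy.
rewrite -zy truncated_ge/=; apply: truncated_leP => x v _ xv.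
have := le_trans (psi_growth x) xv; rewrite lee_fin.
have := cauchy_schwarz z x; have : enorm z * enorm x <= a * enorm x.
  by rewrite ler_wpM2r// zy.
lra.
Qed.

Lemma Conv_c_legendre_mean : Conv_c (legendre mean_legendre).
Proof.
have growth x : ((a * enorm x + b)%:E <= legendre mean_legendre x)%E.
  have [x0'|x0'] := eqVneq (enorm x) 0.
    have := le_legendre x (@mean_legendre_ball 0 _); rewrite enorm0 (ltW a_gt0) => /(_ isT).
    by rewrite inner0r x0' mulr0 sub0r opprK add0r.
  have := le_legendre x (@mean_legendre_ball ((a / enorm x) *: x) _).
  rewrite enormZ ger0_norm ?divr_ge0 ?(ltW a_gt0)// mulfVK// lexx => /(_ isT).
  by rewrite innerZr -sqr_enorm expr2 mulrA mulfVK// opprK.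
have Ny x : legendre mean_legendre x != -oo%E.
  by apply: contraTneq (growth x) => ->.
split => //.
- move=> x y l l01; apply: epi_convex_le => //; exact: legendre_convex.
- exact: legendre_lsc.
- exists 0; have : (legendre mean_legendre 0 <= v0%:E)%E.
    apply/legendre_leP => y v /(le_trans (mean_legendre_ge y)).
    by rewrite lee_fin inner0l; lra.
  by apply: contraTneq => ->.
- have aF : Filter (@at_infty R n) := at_infty_filter R n.
  apply/cvgeyPge => A; exists (`|A - b| / a) => // x /=.
  rewrite ltr_pdivrMr// => xA; apply: le_trans (growth x); rewrite lee_fin.
  by have := ler_norm (A - b); lra.
Qed.

Lemma is_psi_sym_legendre_mean : is_psi_sym eta psi (legendre mean_legendre).
Proof.
split; first exact: Conv_c_legendre_mean.
  exact/legendre_radial/mean_legendre_radial.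
move=> x; apply: fenchel_moreau mean_legendre_convex mean_legendre_lsc
  mean_legendre_ge _ x.
by exists 0, (- m); exact: mean_legendre0.
Qed.

(** This is uniqueness: a solution equals its biconjugate, and its conjugate is prescribed. The
    lower bound that Fenchel-Moreau requires comes from the conjugate at 0. *)
Lemma psi_symE : psi_sym eta psi = legendre mean_legendre.
Proof.
have ex : exists phi, is_psi_sym eta psi phi.
  by exists (legendre mean_legendre); exact: is_psi_sym_legendre_mean.
have [[Ny cphi lphi [x1 px1] _] _ Lphi] := xgetPex (fun=> +oo%E) ex.
rewrite -[xget _ _]/(psi_sym eta psi) in Ny cphi lphi px1 Lphi *.
have cE : epi_convex (psi_sym eta psi).
  move=> x y c d l xc yd /andP[l0 l1]; apply: le_trans (cphi _ _ _ _) _.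
    by rewrite l0.
  rewrite [leRHS]EFinD !EFinM leeD// lee_wpmul2l// lee_fin; lra.
have ge x : (m%:E <= psi_sym eta psi x)%E.
  have /legendre_leP h : (legendre (psi_sym eta psi) 0 <= (- m)%:E)%E.
    by rewrite Lphi; exact: mean_legendre0.
  case E : (psi_sym eta psi x) (Ny x) => [r| |]// _; last by rewrite leey.
  by rewrite lee_fin; have := h x r; rewrite E lexx inner0l => /(_ isT); lra.
have pr : epi_proper (psi_sym eta psi).
  exists x1, (fine (psi_sym eta psi x1)); rewrite fineK//.
  by rewrite fin_numE Ny px1.
apply/funext => x; rewrite -(fenchel_moreau cE lphi ge pr); congr legendre.
by apply/funext => y; exact: Lphi.
Qed.

Lemma psi_sym_ge x : (m%:E <= psi_sym eta psi x)%E.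
Proof.
rewrite psi_symE; apply: le_trans (le_legendre x mean_legendre0).
by rewrite inner0r lee_fin sub0r opprK.
Qed.

(* If the supremum defining [legendre psi] needs arbitrarily large points on
   the sphere of radius [t |y|], then [legendre psi] is [+oo] on an open subset
   of the sphere of radius [|y|], so that its mean there is infinite. *)
Lemma truncated_exact y t : (mean_legendre y < +oo)%E -> 0 <= t < 1 ->
  exists N, forall z, enorm z = t * enorm y ->
    (legendre psi z <= (truncated N z)%:E)%E.
Proof.
move=> yfin /andP[t0 t1]; apply: contrapT => /forallNP bad.
set s := enorm y; have s0 : 0 <= s by exact: enorm_ge0.
pose C := s * enorm x0 + `|v0|.
have C0 : 0 <= C by rewrite addr_ge0// mulr_ge0.
have ts : t * s <= s by rewrite ler_piMl// ltW.
(* If truncation [N] falls short at [z] with [|z| = t * s], some [x] beyond its radius satisfies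
   [<z, x> - v > truncated N z >= - C], whence [v <= t * s * |x| + C]. *)
have /choice[x xP] : forall N, exists x, [/\ N%:R < enorm x &
    exists2 v, (psi x <= v%:E)%E & v <= t * s * enorm x + C].
  move=> N; have /existsNP[z /not_implyP[zs /negP]] := bad N.
  rewrite -ltNge => /legendre_gtP[x [v [xv zx]]]; exists x; split.
    rewrite ltNge; apply/negP => xN; move: zx; rewrite ltNge => /negP; apply.
    by apply: truncated_ub => //; rewrite (le_trans xN)// lerDr.
  exists v => //; have := truncated_ge N z; have := cauchy_schwarz z x.
  rewrite zs -/s; have : t * s * enorm x0 <= s * enorm x0 by rewrite ler_wpM2r.
  by rewrite /C; lra.
have x_gt0 N : 0 < enorm (x N).
  by have [h _] := xP N; apply: le_lt_trans h.
(* For [s = 0] the values at the points [x N] are bounded by [C], which contradicts linear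
   growth. *)
have [s0'|sp] := eqVneq s 0.
  pose N := (Num.truncn (`|C - b| / a)).+1.
  have [xN [v xv vC]] := xP N; have := le_trans (psi_growth (x N)) xv.
  rewrite lee_fin; move: vC; rewrite s0' mulr0 mul0r add0r.
  have : `|C - b| < a * enorm (x N).
    rewrite mulrC -ltr_pdivrMr//; apply: lt_trans xN.
    exact: Num.Theory.truncnS_gt.
  by have := ler_norm (C - b); lra.
have s_gt0 : 0 < s by rewrite lt0r sp.
(* Thus [s - t * s = 4 * d]. If [z] on the sphere of radius [s] is within [d] of [s *: e'], and
   [e N] within [d / s] of [e'], the two errors leave [<z, e N> >= t * s + 2 * d]; the truncation at
   [z] then exceeds [- C] by at least [2 * d * |x N|]. *)
pose d := (1 - t) * s / 4.
have d0 : 0 < d by rewrite divr_gt0// mulr_gt0// subr_gt0.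
pose e N := (enorm (x N))^-1 *: x N.
have e1 N : enorm (e N) = 1.
  by rewrite enormZ ger0_norm ?invr_ge0// mulVf// gt_eqF.
have [e' [e'1 ecl]] : [set z : 'cV[R]_n | enorm z = 1] `&` cluster (e @ \oo) !=set0.
  by apply: compact_sphere; exists 0%N => // N _; exact: e1.
have [K mixK] := mixing s n_gt0 d0.
have [|us [us1 szus usP]] := mixK (s *: e').
  by rewrite enormZ e'1 mulr1 ger0_norm.
have [r yr] : exists r, (mean_legendre y <= r%:E)%E.
  case: (mean_legendre y) yfin => [r| |]// _; first by exists r.
  by exists 0; rewrite leNye.
(* Once [|x N| > B], the lower bound [- C + 2 * d * |x N| / 2 ^+ K] for the mean exceeds its upper
   bound [r]. *)
pose B := `|r + C| * 2 ^+ K / (2 * d).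
have ds : 0 < d / s by rewrite divr_gt0.
have [||z []] := ecl [set e N | N in [set N | ((Num.truncn B).+1 <= N)%N]]
  [set z | enorm (z - e') < d / s].
- by exists (Num.truncn B).+1 => // N /= BN; exists N.
- by apply/nbhs_enormP; exists (d / s).
move=> [N /= BN <-] /= ee'.
have [xN [v xv vC]] := xP N.
have Bx : B < enorm (x N).
  apply: lt_trans xN; apply: lt_le_trans (Num.Theory.truncnS_gt B) _.
  by rewrite ler_nat.
pose M := (Num.truncn (enorm (x N))).+1.
have xM : enorm (x N) <= trunc_radius M.
  have := Num.Theory.truncnS_gt (enorm (x N)); rewrite -/M /trunc_radius => h.
  by have := enorm_ge0 x0; lra.
pose h := 2 * d * enorm (x N).
have h0 : 0 <= h by rewrite mulr_ge0// mulr_ge0// ltW.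
have tL := truncated_lipschitz M.
have low z' : enorm z' = s -> - C + h / 2 ^+ K <= avg_seq us (truncated M) z'.
  apply: usP => // [z'' zs|z'' zs zd]; first by have := truncated_ge M z''; rewrite zs.
  apply: le_trans (truncated_ub z'' xM xv).
  have -> : x N = enorm (x N) *: e N.
    by rewrite scalerA divff ?scale1r// gt_eqF.
  rewrite innerZr.
  have h1 : s * enorm (e' - e N) <= d by rewrite enormB mulrC -ler_pdivlMr// ltW.
  have := cauchy_schwarz z'' (e' - e N); rewrite zs innerDr innerNr => h2.
  have := cauchy_schwarz (s *: e' - z'') e'.
  rewrite enormB e'1 mulr1 innerDl innerNl innerZl -sqr_enorm e'1 expr1n mulr1 => h3.
  have h4 : t * s + 2 * d <= inner z'' (e N) by rewrite /d in zd h1 *; lra.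
  have := ler_wpM2l (enorm_ge0 (x N)) h4.
  move: vC; rewrite /h; lra.
have := mean_truncated_le M y => /le_trans/(_ yr); rewrite lee_fin.
have /andP[] : - C + h / 2 ^+ K <= haar_mean eta (avg_seq us (truncated M)) y <=
    `|avg_seq us (truncated M) 0| + trunc_radius M * enorm y.
  have uL := avg_seq_lipschitz us1 tL.
  apply: (haar_mean_bounds eta_haar uL) => z' zy.
  rewrite low//=; have := elipschitz_bound z' uL; rewrite zy.
  by apply: le_trans; exact: ler_norm.
rewrite (haar_mean_avg_seq eta_haar _ (trunc_radius_ge0 M) tL us1) => h1 _ h2.
have : `|r + C| < h / 2 ^+ K.
  have d2 : 0 < 2 * d by rewrite mulr_gt0.
  have K0 : 0 < 2 ^+ K :> R by rewrite exprn_gt0.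
  by rewrite ltr_pdivlMr//; move: Bx; rewrite ltr_pdivrMr// [enorm _ * _]mulrC.
by have := ler_norm (r + C); lra.
Qed.

End MeanLegendre.

(** * Convergence of iterated infimal averages *)

Lemma near_all_lt (P : nat -> nat -> Prop) I :
  (forall i, \forall k \near \oo, P i k) ->
  \forall k \near \oo, forall i, (i < I)%N -> P i k.
Proof.
move=> h; elim: I => [|I IH]; first by apply: nearW.
apply: filterS2 IH (h I) => k h1 h2 i; rewrite ltnS leq_eqVlt.
by move=> /predU1P[->//|]; exact: h1.
Qed.

Section Convergence.
Context {R : realType} {n : nat} (n_gt0 : (0 < n)%N).
Variables (eta : probability (borel_mx R n) R) (eta_haar : is_haar eta).
Variables (psi : 'cV[R]_n -> \bar R) (a b m : R) (x0 : 'cV[R]_n) (v0 : R).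
Hypotheses (a_gt0 : 0 < a) (psi_growth : linear_growth a b psi).
Hypotheses (psi_ge : forall x, (m%:E <= psi x)%E) (psi_x0 : (psi x0 <= v0%:E)%E).
Hypotheses (psi_convex : epi_convex psi) (psi_lsc : lower_semicontinuous psi).
Implicit Types (x y z : 'cV[R]_n) (N M k : nat) (c s t e : R).

Local Notation trunc := (truncated psi x0).
Local Notation tmean N := (haar_mean eta (truncated psi x0 N)).
Local Notation Lambda := (mean_legendre eta psi).

Lemma avgs_lipschitz (u : nat -> 'cV[R]_n) (L : R) w k : (forall k, usphere (u k)) ->
  elipschitz L w -> elipschitz L (avgs u w k).
Proof. by move=> u1 wL; elim: k => [//|k IH]; exact: avg_lipschitz. Qed.

Lemma legendre_inf_avgs_ge (u : nat -> 'cV[R]_n) N k y :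
  ((avgs u (trunc N) k y)%:E <= legendre (inf_avgs u psi k) y)%E.
Proof.
elim: k y => [|k IH] y; last exact: legendre_inf_avg_ge.
exact: (truncated_le_legendre psi_ge psi_x0).
Qed.

Lemma legendre_inf_avgs_le (u : nat -> 'cV[R]_n) w s k : (forall k, usphere (u k)) ->
  (forall y, enorm y = s -> (legendre psi y <= (w y)%:E)%E) ->
  forall y, enorm y = s -> (legendre (inf_avgs u psi k) y <= (avgs u w k y)%:E)%E.
Proof.
by move=> u1 wG; elim: k => [//|k IH]; exact: legendre_inf_avg_le.
Qed.

Lemma exists_equidistributing : exists u : nat -> 'cV[R]_n,
  (forall k, usphere (u k)) /\
  forall N rho e, 0 < e -> \forall k \near \oo, forall y, enorm y <= rho ->
    `|avgs u (trunc N) k y - tmean N y| <= e.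
Proof.
(* The triple [(N, i, l)] stands for truncation [N] on the sphere of radius [i / (l + 1)]. *)
pose cf j := odflt (0, 0, 0)%N (unpickle j : option (nat * nat * nat)).
have tL N : elipschitz (trunc_radius x0 N) (trunc N).
  exact: (truncated_lipschitz psi_ge psi_x0).
have [||j|u [u1 uP]] := @exists_mixing_sequence R n (fun j => trunc (cf j).1.1)
  (fun j => (cf j).1.2%:R / (cf j).2.+1%:R) (fun j => trunc_radius x0 (cf j).1.1) n_gt0.
- by move=> j; rewrite divr_ge0.
- by move=> j; exact: trunc_radius_ge0.
- exact: tL.
exists u; split => // N rho e e0.
set L := trunc_radius x0 N; have L0 : 0 <= L by exact: trunc_radius_ge0.
(* Moving [y] radially inwards to the next sphere of radius [i / (l + 1)] changes the average and
   the mean by at most [e / 3] each; the last third is the oscillation on that sphere. *)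
pose l := Num.truncn (3 * L / e).
have Ll : L / l.+1%:R <= e / 3.
  rewrite ler_pdivrMr//; have : 3 * L / e < l.+1%:R by exact: Num.Theory.truncnS_gt.
  by rewrite ltr_pdivrMr//; lra.
have e3 : 0 < e / 3 by rewrite divr_gt0.
have hL := haar_mean_lipschitz eta_haar (tL N).
have := @near_all_lt (fun i k => exists c, forall z, enorm z = i%:R / l.+1%:R ->
  c <= avgs u (trunc N) k z <= c + e / 3) (Num.truncn (rho * l.+1%:R)).+1.
move=> /(_ _)/filterS; apply => [k kP y yr|i]; last first.
  by have := uP (pickle (N, i, l)) _ e3; rewrite /cf pickleK.
have l0 : 0 < l.+1%:R :> R by [].
pose i := Num.truncn (enorm y * l.+1%:R).
have /andP[i1 i2] : i%:R <= enorm y * l.+1%:R < i.+1%:R.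
  by apply: Num.Theory.truncn_itv; rewrite mulr_ge0.
have iI : (i < (Num.truncn (rho * l.+1%:R)).+1)%N.
  by rewrite ltnS; apply: Num.Theory.le_truncn; rewrite ler_pM2r.
pose s : R := i%:R / l.+1%:R; have s0 : 0 <= s by rewrite divr_ge0.
have sy : s <= enorm y by rewrite ler_pdivrMr.
have ys : enorm y - s <= l.+1%:R^-1.
  have : enorm y <= i.+1%:R / l.+1%:R by rewrite ler_pdivlMr// ltW.
  by rewrite -[i.+1%:R]natr1 mulrDl mul1r -/s -lerBlDl.
have [y' [y's yy']] : exists y', enorm y' = s /\ enorm (y - y') <= l.+1%:R^-1.
  have [y0|y0] := eqVneq (enorm y) 0.
    exists y; rewrite subrr enorm0; split; last by rewrite invr_ge0.
    by apply/eqP; rewrite eq_le sy y0 s0.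
  have yp : 0 < enorm y by rewrite lt0r y0/=.
  exists ((s / enorm y) *: y); split.
    by rewrite enormZ ger0_norm ?divr_ge0// mulfVK.
  rewrite -{1}(scale1r y) -scalerBl enormZ ger0_norm.
    by rewrite mulrBl mul1r mulfVK.
  by rewrite subr_ge0 ler_pdivrMr// mul1r.
have [c cP] := kP i iI.
have /andP[c1 c2] := cP y' y's.
have aL := avgs_lipschitz k u1 (tL N).
(* Averages preserve the mean, so it lies in the same short interval as the averaged function. *)
have /andP[h1 h2] : c <= tmean N y' <= c + e / 3.
  rewrite -(haar_mean_avgs eta_haar k y' L0 (tL N) u1).
  by apply: (haar_mean_bounds eta_haar aL) => z; rewrite y's; exact: cP.
have Lyy' : L * enorm (y - y') <= e / 3 by apply: le_trans Ll; rewrite ler_wpM2l.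
have := aL y y'; have := hL y y'; rewrite -/L !ler_norml => /andP[h3 h4] /andP[h5 h6].
move: c1 c2 h1 h2 h3 h4 h5 h6 Lyy'; clear.
move: (avgs u _ k y) (avgs u _ k y') (tmean N y) (tmean N y') => A A' B B'.
by move: (L * _) => r *; apply/andP; split; lra.
Qed.

Variables (u : nat -> 'cV[R]_n) (u1 : forall k, usphere (u k)).
Hypothesis uP : forall N rho e, 0 < e -> \forall k \near \oo,
  forall y, enorm y <= rho -> `|avgs u (trunc N) k y - tmean N y| <= e.

Lemma inf_avgs_convex k : epi_convex (inf_avgs u psi k).
Proof. by elim: k => [//|k IH]; exact: inf_avg_convex. Qed.

Lemma inf_avgs_growth k : linear_growth a b (inf_avgs u psi k).
Proof. by elim: k => [//|k IH]; apply: inf_avg_growth => //; exact: ltW. Qed.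

Lemma inf_avgs_lsc k : lower_semicontinuous (inf_avgs u psi k).
Proof.
by elim: k => [//|k IH]; apply: inf_avg_lsc (inf_avgs_growth k) IH.
Qed.

(** The ball and the level do not depend on [k]; testing the subgradient inequality at such a point
    bounds the proximal points uniformly. *)
Lemma inf_avgs_proper k :
  exists z, enorm z <= enorm x0 /\ (inf_avgs u psi k z <= v0%:E)%E.
Proof.
elim: k => [|k [z [zx zv]]]; first by exists x0.
exists (2^-1 *: (z + reflection (u k) z)); split.
  rewrite enormZ ger0_norm//.
  by have := enormD z (reflection (u k) z); rewrite enorm_reflection//; lra.
have -> : v0 = (v0 + v0) / 2 by field.
by apply: (inf_avg_le _ zv zv); rewrite scalerA divff// scale1r.
Qed.

Lemma inf_avgs_liminf (xs : nat -> 'cV[R]_n) x c : xs @ \oo --> x ->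
  (c%:E < legendre Lambda x)%E ->
  \forall k \near \oo, (c%:E < inf_avgs u psi k (xs k))%E.
Proof.
move=> xsx /legendre_gtP[y [v [yv cv]]].
pose d := inner x y - v - c; have d0 : 0 < d by rewrite /d; lra.
pose q := `|c + d + - m|; have q0 : 0 <= q by exact: normr_ge0.
(* As [c + d = <x, y> - v] and [Lambda 0 <= - m], passing to [(1 - tau) y] loses at most
   [tau * (c + d - m) <= d / 2]. The remaining [d / 2] absorbs the two later errors of size
   [d / 8]. *)
pose tau := d / (2 * (q + d)).
have qd : 0 < 2 * (q + d) by rewrite mulr_gt0// ltr_wpDl.
have tau0 : 0 < tau by rewrite divr_gt0.
have tau1 : tau <= 1 / 2 by rewrite ler_pdivrMr//; lra.
have tauq : tau * (c + d - m) <= d / 2.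
  apply: (@le_trans _ _ (tau * q)); first by rewrite ler_wpM2l ?ler_norm// ltW.
  rewrite /tau mulrAC ler_pdivrMr//; have := mulr_ge0 (ltW d0) (ltW d0); lra.
have t01 : 0 <= 1 - tau < 1 by apply/andP; split; lra.
have t01' : 0 <= 1 - tau <= 1 by apply/andP; split; lra.
have Lt := mean_legendre_convex eta_haar psi_ge psi_x0 yv
  (mean_legendre0 eta_haar psi_ge psi_x0) t01'.
rewrite scaler0 addr0 in Lt.
have [|N goodN] := truncated_exact n_gt0 eta_haar a_gt0 psi_growth psi_ge psi_x0
  (y := y) _ t01; first by rewrite (le_lt_trans yv)// ltry.
set y1 := (1 - tau) *: y in Lt *.
have y1s : enorm y1 = (1 - tau) * enorm y by rewrite enormZ ger0_norm//; lra.
have LN : tmean N y1 <= (1 - tau) * v + (1 - (1 - tau)) * - m.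
  by rewrite -lee_fin; apply: le_trans Lt; exact: (mean_truncated_le eta_haar psi_ge psi_x0).
have d8 : 0 < d / 8 by rewrite divr_gt0.
have near1 := uP N (enorm y1) d8.
have near2 : \forall k \near \oo, `|inner y1 (xs k) - inner y1 x| < d / 8.
  have := near_elipschitz x (elipschitz_inner y1) d8.
  exact: xsx.
apply: filterS2 near1 near2 => k /(_ y1 (lexx _)) h1 h2.
rewrite ltNge; apply/negP => h3.
have := legendre_inf_avgs_le k u1 goodN y1s => /legendre_leP/(_ _ _ h3).
move: h1 h2; rewrite ler_norml ltr_norml => /andP[h4 h5] /andP[h6 h7] h8.
have : inner y1 x = inner x y - tau * inner x y.
  by rewrite innerZl (innerC y); ring.
have : inner x y = d + v + c by rewrite /d; ring.
move=> ->; move: h5 h6 h8 LN tauq d0; clearbody d tau y1; clear => h5 h6 h8 LN tauq d0 h9.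
move: h5 h6 h8 LN; rewrite h9; move: (avgs u _ k y1) (tmean N y1) (inner y1 _) => A B P.
lra.
Qed.

(* The proximal point [p] of [psi_k] at [x] satisfies
   [psi_k p + c |x - p|^2 = <y, x> - L psi_k y] with [y = c (x - p)]; as
   [L psi_k >= Lambda - o(1)] on bounded sets, this is at most
   [L Lambda x + o(1)]. *)
Lemma inf_avgs_recovery x v e : (legendre Lambda x <= v%:E)%E -> 0 < e ->
  \forall k \near \oo, exists z, enorm (z - x) < e /\
    (inf_avgs u psi k z <= (v + e)%:E)%E.
Proof.
move=> xv e0; pose e' := Num.min e 1.
have e'0 : 0 < e' by rewrite lt_min e0 ltr01.
have e'e : e' <= e by rewrite ge_min lexx.
have e'1 : e' <= 1 by rewrite ge_min lexx orbT.
(* If [|x - p| >= e], then [c |x - p|^2 >= |v + 1 - b| + 1]; with [psi_k p >= b] this contradicts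
   [psi_k p + c |x - p|^2 <= v + e' <= v + 1]. *)
pose c := (`|v + 1 - b| + 1) / e ^+ 2.
have c0 : 0 < c by rewrite divr_gt0 ?exprn_gt0// ltr_wpDl.
pose D := enorm x + enorm x0; have D0 : 0 <= D by rewrite addr_ge0.
(* A bound for [d = |x - p|] valid for all [k]: the subgradient inequality at the point of
   [inf_avgs_proper] yields [c * (d * (d - D)) <= v0 - b], which fails for [d > d0]. *)
pose d0 := D + 1 + `|v0 - b| / c.
pose rho := c * d0.
(* The means increase with [N] to [Lambda], and [Lambda y >= <x, y> - v]; compactness gives one [N]
   for all slopes in the ball, as in Dini's theorem. *)
have [||y _|N NP] := @compact_uniform _ [set y : 'cV[R]_n | enorm y <= rho]
    (fun N y => inner x y - tmean N y < v + e' / 2).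
- exact: compact_enorm_le.
- move=> N y; apply: le_lt_trans; rewrite lerD2l lerN2.
  apply: le_haar_mean => [|||z _] //.
  + exact: (truncated_lipschitz psi_ge psi_x0).
  + exact: (truncated_lipschitz psi_ge psi_x0).
  + exact: (truncated_mono psi_ge psi_x0).
- have : ((inner x y - v - e' / 2)%:E < Lambda y)%E.
    rewrite ltNge; apply/negP => h; move/legendre_leP: xv => /(_ _ _ h); lra.
  move=> /(mean_legendre_gt eta_haar psi_ge psi_x0)[N hN]; exists N.
  have hL := haar_mean_lipschitz eta_haar (truncated_lipschitz psi_ge psi_x0 N).
  have gL := elipschitzD (elipschitz_inner x) (elipschitzZ (-1) hL).
  have g0 : 0 < v + e' / 2 - (inner x y - tmean N y) by lra.
  have := near_elipschitz y gL g0; apply: filterS => z.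
  by rewrite ltr_norml => /andP[_]; lra.
have e2 : 0 < e' / 2 by rewrite divr_gt0.
apply: filterS (uP N rho e2) => k kP.
have bk z : (b%:E <= inf_avgs u psi k z)%E.
  by apply: le_trans (inf_avgs_growth k z); rewrite lee_fin lerDr mulr_ge0// ltW.
have [z0 [z0x z0v]] := inf_avgs_proper k.
have [|p [r [pr prox]]] := proximal_point x (@inf_avgs_convex k) (@inf_avgs_lsc k) bk _ c0.
  by exists z0, v0.
have br : b <= r by rewrite -lee_fin -pr.
pose d := enorm (x - p).
have d_ge0 : 0 <= d by exact: enorm_ge0.
have dd0 : d <= d0.
  have := prox _ _ z0v.
  have -> : inner (x - p) (z0 - p) = d ^+ 2 - inner (x - p) (x - z0).
    by rewrite sqr_enorm -innerNr -innerDr; congr inner; apply/colP => i; rewrite !mxE; ring.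
  have := cauchy_schwarz (x - p) (x - z0); rewrite -/d => h1 h2.
  rewrite leNgt; apply/negP => dd0.
  have h3 : enorm (x - z0) <= D.
    by have := enormD x (- z0); rewrite enormN /D; lra.
  have h4 : d * enorm (x - z0) <= d * D by rewrite ler_wpM2l.
  have h5 : c * (d * (d - D)) <= v0 - b.
    have : c * (d * (d - D)) <= c * (d ^+ 2 - inner (x - p) (x - z0)).
      by rewrite ler_pM2l//; lra.
    lra.
  have d1 : 1 <= d.
    have : 0 <= `|v0 - b| / c by rewrite divr_ge0// ltW.
    by move: dd0; rewrite /d0; lra.
  have h6 : d0 - D <= d * (d - D).
    have dD : 0 <= d - D.
      have : 0 <= `|v0 - b| / c by rewrite divr_ge0// ltW.
      by move: dd0; rewrite /d0; lra.
    by apply: (@le_trans _ _ (d - D)); [lra|rewrite ler_peMl].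
  have : c * (d0 - D) <= v0 - b by apply: le_trans h5; rewrite ler_pM2l.
  have -> : c * (d0 - D) = c + `|v0 - b| by rewrite /d0; field; exact: lt0r_neq0.
  by have := ler_norm (v0 - b); lra.
set y := c *: (x - p) in kP *.
have yr : enorm (c *: (x - p)) <= rho by rewrite enormZ gtr0_norm// ler_pM2l.
have := kP _ yr; have := NP _ yr.
have Ly : (legendre (inf_avgs u psi k) (c *: (x - p)) <=
    (inner (c *: (x - p)) p - r)%:E)%E.
  by apply/legendre_leP => z w /prox; rewrite !innerZl innerDr innerNr; lra.
have := le_trans (legendre_inf_avgs_ge u N k _) Ly; rewrite lee_fin.
set y' := c *: (x - p); move=> h1 h2; rewrite ler_norml => /andP[h3 h4].
have h5 : inner x y' - inner y' p = c * d ^+ 2.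
  by rewrite sqr_enorm (innerC x) -innerNr -innerDr innerZl.
have h6 : r + c * d ^+ 2 <= v + e' by lra.
exists p; split; last first.
  rewrite pr lee_fin; have := mulr_ge0 (ltW c0) (sqr_ge0 d); lra.
rewrite enormB -/d ltNge; apply/negP => ed.
have : c * e ^+ 2 <= c * d ^+ 2 by rewrite ler_pM2l// !expr2 ler_pM// ltW.
have -> : c * e ^+ 2 = `|v + 1 - b| + 1.
  by rewrite /c mulfVK// expf_neq0// gt_eqF.
by have := ler_norm (v + 1 - b); lra.
Qed.

End Convergence.

(** * Functions and base functions *)

Section ScalarTransform.
Context {R : realType} (alpha : R) (alpha_le0 : alpha <= 0).
Implicit Types (p q s t l : R).

Definition base_scalar t : R :=
  if alpha == 0 then - ln t else (1 - t `^ alpha) / alpha.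

(* The inverse of [base_scalar] on the values [p] with [0 < 1 - alpha * p];
   elsewhere [powR] takes junk values. *)
Definition unbase_scalar p : R :=
  if alpha == 0 then expR (- p) else (1 - alpha * p) `^ alpha^-1.

Lemma base_scalar_dom t : 0 < t -> 0 < 1 - alpha * base_scalar t.
Proof.
rewrite /base_scalar; case: eqVneq => [-> _|a0 t0]; first by rewrite mul0r subr0.
by rewrite mulrC mulfVK// subKr powR_gt0.
Qed.

Lemma base_scalarK t : 0 < t -> unbase_scalar (base_scalar t) = t.
Proof.
move=> t0; rewrite /base_scalar /unbase_scalar; case: eqVneq => a0.
  by rewrite opprK lnK.
by rewrite mulrC mulfVK// subKr -powRrM divff// powRr1// ltW.
Qed.

Lemma unbase_scalar_gt0 p : 0 < 1 - alpha * p -> 0 < unbase_scalar p.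
Proof.
by rewrite /unbase_scalar; case: eqVneq => _ h; [exact: expR_gt0|exact: powR_gt0].
Qed.

Lemma unbase_scalarK p : 0 < 1 - alpha * p -> base_scalar (unbase_scalar p) = p.
Proof.
move=> p0; rewrite /base_scalar /unbase_scalar; case: eqVneq => a0.
  by rewrite expRK opprK.
by rewrite -powRrM mulVf// powRr1 ?(ltW p0)// subKr mulrC mulKf.
Qed.

Lemma scalar_dom_le p q : 0 < 1 - alpha * p -> p <= q -> 0 < 1 - alpha * q.
Proof. by move=> p0 /(ler_wnM2l alpha_le0); lra. Qed.

Lemma unbase_scalar_le p q : 0 < 1 - alpha * p -> p <= q ->
  unbase_scalar q <= unbase_scalar p.
Proof.
move=> p0 pq; have q0 := scalar_dom_le p0 pq; rewrite /unbase_scalar.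
case: eqVneq => a0; first by rewrite ler_expR lerN2.
rewrite -[alpha^-1]opprK !(powRN _ (- alpha^-1)).
rewrite lef_pV2 ?posrE ?powR_gt0//; apply: ge0_ler_powR.
- by rewrite oppr_ge0 invr_le0.
- by rewrite nnegrE ltW.
- by rewrite nnegrE ltW.
- by rewrite lerD2l lerN2 ler_wnM2l.
Qed.

Lemma unbase_scalar_lt p q : 0 < 1 - alpha * p -> p < q ->
  unbase_scalar q < unbase_scalar p.
Proof.
move=> p0 pq; rewrite lt_neqAle unbase_scalar_le ?(ltW pq)// andbT.
have q0 := scalar_dom_le p0 (ltW pq).
apply: contraTneq pq => h.
by rewrite -(unbase_scalarK p0) -h unbase_scalarK// ltxx.
Qed.

Lemma base_scalar_le s t : 0 < s -> s <= t -> base_scalar t <= base_scalar s.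
Proof.
move=> s0 st; rewrite leNgt; apply/negP => h.
have := unbase_scalar_lt (base_scalar_dom s0) h.
by rewrite !base_scalarK ?(lt_le_trans s0)// ltNge st.
Qed.

Lemma base_scalar_lt s t : 0 < s -> s < t -> base_scalar t < base_scalar s.
Proof.
move=> s0 st; have t0 := lt_trans s0 st; rewrite ltNge; apply/negP => h.
have := unbase_scalar_le (base_scalar_dom s0) h.
by rewrite !base_scalarK// leNgt st.
Qed.

(** In base coordinates power means are arithmetic means, which makes alpha-concavity of [f] into
    convexity of its base function. *)
Lemma power_mean_unbase s t l : 0 < s -> 0 < t ->
  (if alpha == 0 then s `^ l * t `^ (1 - l)
   else (l * s `^ alpha + (1 - l) * t `^ alpha) `^ alpha^-1) =
  unbase_scalar (l * base_scalar s + (1 - l) * base_scalar t).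
Proof.
move=> s0 t0; rewrite /unbase_scalar /base_scalar; case: eqVneq => a0.
  rewrite /powR !gt_eqF// -expRD; congr expR; ring.
congr (_ `^ _); field; exact: a0.
Qed.

Lemma scalar_dom_convex p q l : 0 < 1 - alpha * p -> 0 < 1 - alpha * q ->
  0 <= l <= 1 -> 0 < 1 - alpha * (l * p + (1 - l) * q).
Proof.
wlog pq : p q l / p <= q.
  move=> h p0 q0 /andP[l0 l1]; have [pq|qp] := leP p q.
    by apply: h => //; rewrite l0.
  have -> : l * p + (1 - l) * q = (1 - l) * q + (1 - (1 - l)) * p by ring.
  by apply: h => //; [exact: ltW|apply/andP; split; lra].
move=> p0 _ /andP[l0 l1]; apply: scalar_dom_le p0 _.
have : 0 <= 1 - l by lra.
by move=> /ler_wpM2l/(_ _ _ pq); lra.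
Qed.

End ScalarTransform.

(** * Semicontinuity, convexity and symmetrals in terms of base functions *)

Section BaseTransform.
Context {R : realType} {n : nat} (alpha : R) (alpha_le0 : alpha <= 0).
Implicit Types (f : 'cV[R]_n -> R) (x y z u p q : 'cV[R]_n) (c v t M : R).
Local Notation bs := (base_scalar alpha).
Local Notation ub := (unbase_scalar alpha).

Lemma baseE f x : base alpha f x = if f x == 0 then +oo%E else (bs (f x))%:E.
Proof. by rewrite /base /base_scalar; case: ifP => // _; case: ifP. Qed.

Lemma unbaseE (psi : 'cV[R]_n -> \bar R) x :
  unbase alpha psi x = if psi x == +oo%E then 0 else ub (fine (psi x)).
Proof. by []. Qed.

Lemma base_leP f x v : (forall x, 0 <= f x) ->
  (base alpha f x <= v%:E)%E <-> 0 < f x /\ bs (f x) <= v.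
Proof.
move=> f0; rewrite baseE; case: eqVneq => [->|fx].
  by split=> [|[]]; rewrite ?ltxx// leye_eq.
have fx0 : 0 < f x by rewrite lt0r fx f0.
by rewrite lee_fin fx0; split=> [|[]].
Qed.

Lemma base_lt f x t : (forall x, 0 <= f x) -> 0 < t ->
  ((bs t)%:E < base alpha f x)%E = (f x < t).
Proof.
move=> f0 t0; apply/idP/idP => [h|h].
  rewrite ltNge; apply/negP => tf; have fx := lt_le_trans t0 tf; move: h.
  rewrite ltNge => /negP; apply; apply/base_leP => //; split => //.
  exact: base_scalar_le.
rewrite ltNge; apply/negP => /(base_leP _ _ f0)[fx].
by rewrite leNgt base_scalar_lt.
Qed.

Lemma base_le f x t : (forall x, 0 <= f x) -> 0 < t ->
  (base alpha f x <= (bs t)%:E)%E = (t <= f x).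
Proof. by move=> f0 t0; rewrite leNgt base_lt// -leNgt. Qed.

Lemma base_ge f M x : (forall x, 0 <= f x) -> 0 < M -> (forall x, f x <= M) ->
  ((bs M)%:E <= base alpha f x)%E.
Proof.
move=> f0 M0 fM; rewrite baseE; case: eqVneq => [_|fx]; first by rewrite leey.
by rewrite lee_fin base_scalar_le// lt0r fx f0.
Qed.

Lemma base_unbase (psi : 'cV[R]_n -> \bar R) m x : 0 < 1 - alpha * m ->
  (forall x, (m%:E <= psi x)%E) -> base alpha (unbase alpha psi) x = psi x.
Proof.
move=> m0 mpsi; rewrite baseE unbaseE.
case E : (psi x) (mpsi x) => [r| |]//; last by rewrite eqxx.
rewrite lee_fin => mr; have r0 := scalar_dom_le alpha_le0 m0 mr.
by rewrite gt_eqF ?unbase_scalar_gt0//= unbase_scalarK.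
Qed.

Lemma unbase_ge0 (psi : 'cV[R]_n -> \bar R) x : 0 <= unbase alpha psi x.
Proof.
rewrite unbaseE; case: ifP => // _; rewrite /unbase_scalar.
by case: ifP => _; [exact: expR_ge0|exact: powR_ge0].
Qed.

Lemma base_convex f : (forall x, 0 <= f x) -> alpha_concave alpha f ->
  epi_convex (base alpha f).
Proof.
move=> f0 [_ fc] x y a b l /(base_leP _ _ f0)[fx xa] /(base_leP _ _ f0)[fy yb] l01.
have := fc x y l fx fy l01; rewrite power_mean_unbase//.
set w := l * bs (f x) + (1 - l) * bs (f y) => h.
have w0 : 0 < 1 - alpha * w.
  by apply: scalar_dom_convex => //; exact: base_scalar_dom.
have ub0 := unbase_scalar_gt0 w0.
apply/base_leP => //; split; first exact: lt_le_trans h.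
apply: le_trans (base_scalar_le alpha_le0 ub0 h) _.
rewrite unbase_scalarK//; case/andP: l01 => l0 l1.
by rewrite lerD// ler_wpM2l// subr_ge0.
Qed.

Lemma base_lsc f : (forall x, 0 <= f x) -> upper_semicontinuous f ->
  lower_semicontinuous (base alpha f).
Proof.
move=> f0 uf x a ax; have [a0|a0] := ltP 0 (1 - alpha * a).
  have u0 := unbase_scalar_gt0 a0.
  rewrite -(unbase_scalarK a0) base_lt// in ax.
  exists [set y | f y < ub a]; first exact: uf.
  by move=> y /= fy; rewrite -(unbase_scalarK a0) base_lt.
(* Here [a] lies below the range of [base_scalar], so every point qualifies. *)
exists setT; first exact: filterT.
move=> y _; rewrite baseE; case: eqVneq => [_|fy]; first by rewrite ltry.
have := base_scalar_dom alpha (_ : 0 < f y); rewrite lt0r fy f0 => /(_ isT) d.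
rewrite lte_fin ltNge; apply/negP => h.
by have := scalar_dom_le alpha_le0 d h; rewrite ltNge a0.
Qed.

Section Symmetral.
Variables (f : 'cV[R]_n -> R) (M : R).
Hypotheses (f_ge0 : forall x, 0 <= f x) (M_gt0 : 0 < M) (f_le : forall x, f x <= M).

(** At [alpha = 0] the geometric mean vanishes with either factor, so one formula covers both cases
    of the definition. *)
Lemma symmetral_termE a b : 0 <= a -> 0 <= b ->
  (if alpha == 0 then Num.sqrt (a * b)
   else if (a == 0) || (b == 0) then 0
   else (2^-1 * a `^ alpha + 2^-1 * b `^ alpha) `^ alpha^-1) =
  if (a == 0) || (b == 0) then 0 else ub ((bs a + bs b) / 2).
Proof.
move=> a0 b0; have [->|an0] := eqVneq a 0; first by rewrite mul0r sqrtr0 if_same.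
have [->|bn0] := eqVneq b 0; first by rewrite mulr0 sqrtr0 if_same.
have {a0}a0 : 0 < a by rewrite lt0r an0.
have {b0}b0 : 0 < b by rewrite lt0r bn0.
have := power_mean_unbase alpha 2^-1 a0 b0.
rewrite -[1 - 2^-1](_ : 2^-1 = _); last by field.
have -> : (bs a + bs b) / 2 = 2^-1 * bs a + 2^-1 * bs b by field.
move=> <- /=.
by case: ifP => // _; rewrite sqrtrM ?(ltW a0)// !powR12_sqrt// ltW.
Qed.

Let S u x := [set t | exists y z, y + z = x /\ t =
  if (f (2 *: y) == 0) || (f (reflection u (2 *: z)) == 0) then 0
  else ub ((bs (f (2 *: y)) + bs (f (reflection u (2 *: z)))) / 2)].

Let symmetralE u x : symmetral alpha u f x = sup (S u x).
Proof.
rewrite /symmetral; congr sup; apply/seteqP; split=> t [y [z [yz ->]]].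
  by exists y, z; rewrite symmetral_termE.
by exists y, z; rewrite symmetral_termE.
Qed.

Let S_bounds u x t : S u x t -> 0 <= t <= M.
Proof.
move=> [y [z [_ ->]]]; case: ifP => [_|/negbT]; first by rewrite lexx ltW.
rewrite negb_or => /andP[fy fz].
have a0 : 0 < f (2 *: y) by rewrite lt0r fy f_ge0.
have b0 : 0 < f (reflection u (2 *: z)) by rewrite lt0r fz f_ge0.
have h : bs M <= (bs (f (2 *: y)) + bs (f (reflection u (2 *: z)))) / 2.
  have := base_scalar_le alpha_le0 a0 (f_le _).
  by have := base_scalar_le alpha_le0 b0 (f_le _); lra.
have MM := base_scalar_dom alpha M_gt0.
rewrite ltW ?unbase_scalar_gt0//=; last exact: scalar_dom_le h.
by rewrite -[leRHS](base_scalarK alpha M_gt0) unbase_scalar_le.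
Qed.

Let S_has_sup u x : has_sup (S u x).
Proof.
split; last by exists M => t /S_bounds/andP[].
by eexists; exists x, 0; rewrite addr0; split.
Qed.

Lemma symmetral_ge0 u x : 0 <= symmetral alpha u f x.
Proof.
rewrite symmetralE; have [[t St] _] := S_has_sup u x.
have /andP[t0 _] := S_bounds St.
by apply: le_trans t0 _; apply: sup_upper_bound.
Qed.

Lemma symmetral_le u x : symmetral alpha u f x <= M.
Proof.
rewrite symmetralE; apply: sup_le_ub; first by case: (S_has_sup u x).
by move=> t /S_bounds/andP[].
Qed.

Lemma base_symmetral u : usphere u ->
  base alpha (symmetral alpha u f) = inf_avg u (base alpha f).
Proof.
move=> u1; apply/funext => x.
have le1 c : (inf_avg u (base alpha f) x <= c%:E)%E ->
    (base alpha (symmetral alpha u f) x <= c%:E)%E.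
  move=> h; apply/lee_addgt0Pr => e e0; rewrite -EFinD.
  have [p [q [a [b [pq /(base_leP _ _ f_ge0)[fp pa] /(base_leP _ _ f_ge0)[fq qb] ab]]]]] :=
    inf_avg_leP e0 h.
  pose w := (bs (f p) + bs (f q)) / 2.
  have w0 : 0 < 1 - alpha * w.
    have -> : w = 2^-1 * bs (f p) + (1 - 2^-1) * bs (f q) by rewrite /w; field.
    apply: scalar_dom_convex => //; [exact: base_scalar_dom|exact: base_scalar_dom|].
    by apply/andP; split; lra.
  have wS : ub w <= symmetral alpha u f x.
    rewrite symmetralE; apply: sup_upper_bound => //.
    (* The symmetral doubles its arguments and reflects the second, so these witnesses evaluate [f]
       at [p] and [q]. *)
    exists (2^-1 *: p), (2^-1 *: reflection u q); split.
      by rewrite -scalerDr pq scalerA mulVf// scale1r.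
    by rewrite !scalerA divff// !scale1r reflectionK// !gt_eqF.
  have ub0 := unbase_scalar_gt0 w0.
  apply/(base_leP _ _ (symmetral_ge0 u)); split; first exact: lt_le_trans wS.
  apply: le_trans (base_scalar_le alpha_le0 ub0 wS) _.
  by rewrite unbase_scalarK// /w; lra.
have le2 c : (base alpha (symmetral alpha u f) x <= c%:E)%E ->
    (inf_avg u (base alpha f) x <= c%:E)%E.
  move=> /(base_leP _ _ (symmetral_ge0 u))[s0 sc].
  apply/lee_addgt0Pr => e e0; rewrite -EFinD.
  have sd := base_scalar_dom alpha s0.
  have ce : bs (symmetral alpha u f x) < c + e by lra.
  have := unbase_scalar_lt alpha_le0 sd ce; rewrite base_scalarK// {1}symmetralE.
  have ced := scalar_dom_le alpha_le0 sd (ltW ce).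
  move=> /sup_gt[|t [y [z [yz ->]]]]; first by case: (S_has_sup u x).
  case: ifP => [_|/negbT]; first by rewrite ltNge ltW ?unbase_scalar_gt0.
  rewrite negb_or => /andP[fy fz] h.
  have fy0 : 0 < f (2 *: y) by rewrite lt0r fy f_ge0.
  have fz0 : 0 < f (reflection u (2 *: z)) by rewrite lt0r fz f_ge0.
  apply: le_trans (@inf_avg_le _ _ u (base alpha f) x (2 *: y)
    (reflection u (2 *: z)) _ _ _ _ _) _.
  - by rewrite reflectionK// -scalerDr yz.
  - by apply/base_leP => //; split => //; exact: lexx.
  - by apply/base_leP => //; split => //; exact: lexx.
  rewrite lee_fin leNgt; apply/negP => cw.
  by have := unbase_scalar_le alpha_le0 ced (ltW cw); rewrite leNgt h.
apply/eqP; rewrite eq_le; apply/andP; split.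
  case E : (inf_avg u (base alpha f) x) => [r| |]; first by apply: le1; rewrite E.
    by rewrite leey.
  rewrite leNgt; apply/negP => h.
  have := base_ge x (symmetral_ge0 u) M_gt0 (symmetral_le u).
  have := le1 (bs M - 1); rewrite E leNye => /(_ isT) h1 /le_trans/(_ h1).
  by rewrite lee_fin; lra.
rewrite baseE; case: ifP => [_|/negbT s0]; first by rewrite leey.
by apply: le2; rewrite baseE (negbTE s0).
Qed.

End Symmetral.

Lemma symmetrals_bounds (u : nat -> 'cV[R]_n) f M k : 0 < M ->
  (forall x, 0 <= f x) -> (forall x, f x <= M) ->
  (forall x, 0 <= symmetrals alpha u f k x) /\ (forall x, symmetrals alpha u f k x <= M).
Proof.
move=> M0 f0 fM; elim: k => [//|k [IH1 IH2]] /=; split=> x.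
  exact: (symmetral_ge0 IH1 M0 IH2).
exact: symmetral_le.
Qed.

Lemma base_symmetrals (u : nat -> 'cV[R]_n) f M k : (forall k, usphere (u k)) ->
  0 < M -> (forall x, 0 <= f x) -> (forall x, f x <= M) ->
  base alpha (symmetrals alpha u f k) = inf_avgs u (base alpha f) k.
Proof.
move=> u1 M0 f0 fM; elim: k => [//|k IH] /=; rewrite -IH.
by have [h1 h2] := symmetrals_bounds u k M0 f0 fM; exact: base_symmetral h1 M0 h2 _ _.
Qed.

End BaseTransform.

(** * The corollary *)

Section AlphaConcaveFunctions.
Context {R : realType} {n : nat}.
Implicit Types (f : 'cV[R]_n -> R) (x y z : 'cV[R]_n).

Lemma cvg_at_infty_lt f t : f @ at_infty --> (0 : R) -> 0 < t ->
  exists r, forall x, r < enorm x -> f x < t.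
Proof.
move=> f0 t0; have [|r _ rf] := f0 [set s | s < t].
  apply/nbhs_normP; exists t => // s /=; rewrite sub0r normrN => st.
  exact: le_lt_trans (ler_norm s) st.
by exists r => x rx; exact: rf.
Qed.

Lemma usc_cvg0_bounded f : upper_semicontinuous f -> f @ at_infty --> (0 : R) ->
  exists2 M, 0 < M & forall x, f x <= M.
Proof.
move=> uf f0; have [r rf] := cvg_at_infty_lt f0 ltr01.
have [||x _|N NP] := @compact_uniform _ [set x : 'cV[R]_n | enorm x <= r]
  (fun N x => f x < N.+1%:R).
- exact: compact_enorm_le.
- by move=> N x /lt_trans; apply; rewrite ltr_nat.
- exists (Num.truncn (f x)); apply: uf; exact: Num.Theory.truncnS_gt.
exists N.+1%:R => // x; have [xr|xr] := leP (enorm x) r; first exact/ltW/NP.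
by rewrite (le_trans (ltW (rf x xr)))// ler1n.
Qed.

(** A convex function that has risen by 1 at distance [rho] from [x0] keeps rising along the ray at
    rate at least [1 / rho]. *)
Lemma coercive_linear_growth (G : 'cV[R]_n -> \bar R) m x0 v0 r : epi_convex G ->
  (forall x, (m%:E <= G x)%E) -> (G x0 <= v0%:E)%E ->
  (forall x, r < enorm x -> ((v0 + 1)%:E <= G x)%E) ->
  exists a b, 0 < a /\ linear_growth a b G.
Proof.
move=> cG mG Gx0 Gr.
pose rho := Num.max r 0 + enorm x0 + 1.
have r0 : 0 <= Num.max r 0 by rewrite le_max lexx orbT.
have rho0 : 0 < rho by rewrite /rho; have := enorm_ge0 x0; lra.
(* Within distance [rho] of [x0] the linear term gains at most 1, so [m - 1] suffices; farther out
   the rise starts from [v0]. *)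
exists rho^-1, (Num.min (m - 1) v0 - enorm x0 / rho); split; first by rewrite invr_gt0.
move=> x; case E : (G x) (mG x) => [v| |]// mv; last by rewrite leey.
rewrite lee_fin in mv; rewrite lee_fin.
have -> : rho^-1 * enorm x + (Num.min (m - 1) v0 - enorm x0 / rho) =
    (enorm x - enorm x0) / rho + Num.min (m - 1) v0 by ring.
have xx0 := enorm_sub x x0.
have [xr|xr] := ltP (enorm (x - x0)) rho.
  have : (enorm x - enorm x0) / rho <= 1 by rewrite ler_pdivrMr// mul1r; lra.
  have : Num.min (m - 1) v0 <= m - 1 by rewrite ge_min lexx.
  lra.
have d0 : 0 < enorm (x - x0) by exact: lt_le_trans xr.
pose t := rho / enorm (x - x0).
have t0 : 0 < t by rewrite divr_gt0.
have t01 : 0 <= t <= 1 by rewrite ltW//= ler_pdivrMr// mul1r.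
have Gx : (G x <= v%:E)%E by rewrite E.
have := cG _ _ _ _ t Gx Gx0 t01.
set z := _ + _; have zr : r < enorm z.
  have : enorm (z - x0) = rho.
    have -> : z - x0 = t *: (x - x0) by apply/colP => i; rewrite !mxE; ring.
    by rewrite enormZ gtr0_norm// mulfVK// gt_eqF.
  have := enormD z (- x0); rewrite enormN => h1 h2; rewrite h2 in h1.
  have : r <= Num.max r 0 by rewrite le_max lexx.
  by move: h1; rewrite /rho; lra.
move=> /(le_trans (Gr z zr)); rewrite lee_fin => h.
have : t^-1 <= v - v0 by rewrite -(ler_pM2l t0) divff ?gt_eqF//; lra.
rewrite /t invf_div => h'.
have : (enorm x - enorm x0) / rho <= enorm (x - x0) / rho.
  by rewrite ler_pM2r ?invr_gt0.
have : Num.min (m - 1) v0 <= v0 by rewrite ge_min lexx orbT.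
lra.
Qed.

Lemma C_alpha_unbase alpha (phi : 'cV[R]_n -> \bar R) m : alpha <= 0 ->
  0 < 1 - alpha * m -> (forall x, (m%:E <= phi x)%E) -> epi_convex phi ->
  Conv_c phi -> C_alpha alpha (unbase alpha phi).
Proof.
move=> alpha0 m0 mphi cphi [phiNy _ lphi [x1 phix1] phioo].
have ge0 := unbase_ge0 alpha phi.
have bE x := base_unbase alpha0 x m0 mphi.
have fin x : 0 < unbase alpha phi x ->
    exists r, [/\ phi x = r%:E, 0 < 1 - alpha * r &
      base_scalar alpha (unbase alpha phi x) = r].
  move=> fx; have := bE x; rewrite baseE gt_eqF// => <-.
  exists (base_scalar alpha (unbase alpha phi x)); split => //.
  exact: base_scalar_dom.
have cvx x y l : 0 < unbase alpha phi x -> 0 < unbase alpha phi y -> 0 <= l <= 1 ->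
    0 < unbase_scalar alpha (l * base_scalar alpha (unbase alpha phi x) +
          (1 - l) * base_scalar alpha (unbase alpha phi y))
      <= unbase alpha phi (l *: x + (1 - l) *: y).
  move=> fx fy l01; have [p [phip p0 ->]] := fin x fx; have [q [phiq q0 ->]] := fin y fy.
  have w0 := scalar_dom_convex alpha0 p0 q0 l01.
  rewrite unbase_scalar_gt0//= -(base_le alpha0)//; last exact: unbase_scalar_gt0.
  rewrite bE unbase_scalarK//; apply: cphi => //; [by rewrite phip|by rewrite phiq].
split => //.
- split=> [x y l|x y l fx fy l01].
    rewrite !inE /= => fx fy.
    have l01 : 0 <= l%:num <= 1 by apply/andP; split.
    by have /andP[h1 h2] := cvx x y _ fx fy l01; exact: lt_le_trans h2.
  by rewrite power_mean_unbase//; have /andP[] := cvx x y l fx fy l01.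
- move=> x t xt; have t0 : 0 < t by exact: le_lt_trans xt.
  rewrite -(base_lt alpha0)// bE in xt.
  have := lsc_near lphi xt; apply: filterS => y.
  by rewrite -bE (base_lt alpha0).
- exists x1; have := bE x1; rewrite baseE; case: eqVneq => // _ h.
  by rewrite -h eqxx in phix1.
- have aF : Filter (@at_infty R n) := at_infty_filter R n.
  apply/cvgr0Pnorm_lt => e e0.
  have /cvgeyPgt/(_ (base_scalar alpha e)) := phioo.
  apply: filterS => x; by rewrite -bE (base_lt alpha0)// ger0_norm.
Qed.

End AlphaConcaveFunctions.

(** [g k] is the largest [M <= k] whose threshold [T M] is at most [k]. Once [k >= T 0] such an [M]
    exists, and [g k] itself is one. *)
Lemma diagonal_index (P : nat -> nat -> Prop) :
  (forall M, \forall k \near \oo, P M k) ->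
  exists g : nat -> nat, forall M, \forall k \near \oo, (M <= g k)%N /\ P (g k) k.
Proof.
move=> h.
have /choice[T TP] : forall M, exists N, forall k, (N <= k)%N -> P M k.
  by move=> M; have [N _ NP] := h M; exists N => k; exact: NP.
pose g k := \max_(i < k.+1 | (T i <= k)%N) i.
exists g => M; exists (maxn M (maxn (T M) (T 0))) => // k /=.
rewrite !geq_max => /and3P[Mk TMk T0k]; split.
  exact: (@leq_bigmax_cond _ (fun i : 'I_k.+1 => (T i <= k)%N) _ (Ordinal (Mk : (M < k.+1)%N))).
have [|i Ti gi] := @eq_bigmax_cond 'I_k.+1 (fun i => T i <= k)%N (fun i => i).
  by apply/card_gt0P; exists ord0.
by rewrite /g gi; apply: TP.
Qed.

Theorem corollary4p4 (R : realType) (n : nat) (n_gt0 : (0 < n)%N)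
    (eta : probability (borel_mx R n) R) (eta_haar : is_haar eta)
    (alpha : R) (alpha_le0 : alpha <= 0)
    (f : 'cV[R]_n -> R) (f_C : C_alpha alpha f) :
  C_alpha alpha (reflectional_hyposym eta alpha f) /\
  exists u : nat -> 'cV[R]_n,
    (forall k, usphere (u k)) /\
    hypo_cvg (symmetrals alpha u f) (reflectional_hyposym eta alpha f).
Proof.
have [f0 fc uf [x0 fx0] finf] := f_C.
have [M M0 fM] := usc_cvg0_bounded uf finf.
pose psi := base alpha f; pose m := base_scalar alpha M.
have m0 : 0 < 1 - alpha * m by exact: base_scalar_dom.
have psi_ge x : (m%:E <= psi x)%E by exact: base_ge.
have psi_convex : epi_convex psi by exact: base_convex.
have psi_lsc : lower_semicontinuous psi by exact: base_lsc.
have fx0_gt0 : 0 < f x0 by rewrite lt0r fx0 f0.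
pose v0 := base_scalar alpha (f x0).
have v00 : 0 < 1 - alpha * v0 by exact: base_scalar_dom.
have psi_x0 : (psi x0 <= v0%:E)%E by apply/base_leP.
have [a [b [a0 growth]]] : exists a b, 0 < a /\ linear_growth a b psi.
  have v1 : 0 < 1 - alpha * (v0 + 1) by apply: scalar_dom_le v00 _ => //; lra.
  have [r rf] := cvg_at_infty_lt finf (unbase_scalar_gt0 v1).
  apply: (coercive_linear_growth psi_convex psi_ge psi_x0 (r := r)) => x /rf fx.
  rewrite -(unbase_scalarK v1); apply: ltW; rewrite base_lt//.
  exact: unbase_scalar_gt0.
have phiE := psi_symE n_gt0 eta_haar a0 growth psi_ge psi_x0.
set fs := reflectional_hyposym eta alpha f.
have phi_ge := psi_sym_ge n_gt0 eta_haar a0 growth psi_ge psi_x0.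
have fs0 x : 0 <= fs x by exact: unbase_ge0.
have bfs x : base alpha fs x = legendre (mean_legendre eta psi) x.
  by rewrite -phiE; exact: base_unbase m0 phi_ge.
split.
  apply: C_alpha_unbase m0 phi_ge _ _ => //; rewrite phiE.
    exact: legendre_convex.
  exact: Conv_c_legendre_mean growth psi_ge psi_x0.
have [u [u1 uP]] := exists_equidistributing n_gt0 eta_haar psi_ge psi_x0.
exists u; split => // x.
pose fk k := symmetrals alpha u f k.
have fk0 k y : 0 <= fk k y by have [h _] := symmetrals_bounds alpha_le0 u k M0 f0 fM; exact: h.
have bfk k : base alpha (fk k) = inf_avgs u psi k by exact: base_symmetrals M0 f0 fM.
have upper xs t : xs @ \oo --> x -> fs x < t -> \forall k \near \oo, fk k (xs k) < t.
  move=> xsx fst; have t0 : 0 < t by exact: le_lt_trans fst.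
  rewrite -(base_lt alpha_le0)// bfs in fst.
  have := inf_avgs_liminf n_gt0 eta_haar a0 growth psi_ge psi_x0 u1 uP xsx fst.
  by apply: filterS => k; rewrite -bfk base_lt.
split=> [xs xsx|].
  apply/lee_addgt0Pr => e e0; rewrite -EFinD.
  have fse : fs x < fs x + e by rewrite ltrDl.
  apply: (@le_trans _ _ (ereal_sup
    ((fun k => (fk k (xs k))%:E) @` [set k | fk k (xs k) < fs x + e]))).
    apply: ereal_inf_lbound; exists [set k | fk k (xs k) < fs x + e] => //.
    exact: upper.
  by apply: ge_ereal_sup => _ [k /= kt <-]; rewrite lee_fin ltW.
pose P N k := exists z, enorm (z - x) < N.+1%:R^-1 /\ fs x - N.+1%:R^-1 < fk k z.
have PP N : \forall k \near \oo, P N k.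
  have N0 : 0 < N.+1%:R^-1 :> R by rewrite invr_gt0.
  rewrite /P; move: (N.+1%:R^-1) N0 => d d0.
  (* A negative target is met by [x] itself, since the symmetrals are nonnegative; this includes
     [fs x = 0], where the base function is [+oo]. *)
  have [neg|pos] := ltP (fs x - d) 0.
    apply: nearW => k; exists x; rewrite subrr enorm0; split => //.
    exact: lt_le_trans neg _.
  have fsx : 0 < fs x by lra.
  pose t := fs x - d / 2; have t0 : 0 < t by rewrite /t; lra.
  have tfs : t < fs x by rewrite /t; lra.
  pose r := base_scalar alpha (fs x).
  have rt : r < base_scalar alpha t by exact: base_scalar_lt.
  have xr : (legendre (mean_legendre eta psi) x <= r%:E)%E.
    by rewrite -bfs; apply/base_leP.
  (* An increase of at most [base_scalar alpha t - r] in the base function keeps the value of the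
     symmetral at least [t]. *)
  pose e := Num.min (base_scalar alpha t - r) d.
  have e0 : 0 < e by rewrite lt_min d0 andbT subr_gt0.
  have := inf_avgs_recovery eta_haar a0 growth psi_ge psi_x0 psi_convex psi_lsc
    u1 uP xr e0.
  apply: filterS => k [z [zx zr]]; exists z; split.
    by apply: lt_le_trans zx _; rewrite ge_min lexx orbT.
  apply: (@lt_le_trans _ _ t); first by rewrite /t; lra.
  rewrite -(base_le alpha_le0)// bfk; apply: le_trans zr _; rewrite lee_fin.
  have : e <= base_scalar alpha t - r by rewrite ge_min lexx.
  lra.
have [g gP] := diagonal_index PP.
have /choice[xs xsP] : forall k, exists z, P (g k) k ->
    enorm (z - x) < (g k).+1%:R^-1 /\ fs x - (g k).+1%:R^-1 < fk k z.
  by move=> k; have [[z zP]|] := pselect (P (g k) k); [exists z|exists x].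
have small (e : R) : 0 < e -> \forall k \near \oo, P (g k) k /\ (g k).+1%:R^-1 < e.
  move=> e0; apply: filterS (gP (Num.truncn e^-1)) => k [Mg Pk]; split => //.
  rewrite -[ltRHS]invrK ltf_pV2 ?posrE ?invr_gt0//.
  apply: lt_le_trans (Num.Theory.truncnS_gt _) _.
  by rewrite ler_nat.
have xsx : xs @ \oo --> x.
  apply/cvg_enormP => e e0; apply: filterS (small e e0) => k [Pk ge].
  by have [h _] := xsP k Pk; apply: lt_trans ge.
exists xs => //; apply/cvgrPdist_lt => e e0.
have fse : fs x < fs x + e by rewrite ltrDl.
apply: filterS2 (small e e0) (upper xs _ xsx fse) => k [Pk ge] h1.
have [_ h2] := xsP k Pk; rewrite -/(fk k _) ltr_norml; apply/andP; split; first lra.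
apply: lt_trans ge; rewrite ltrBlDr -ltrBlDl; exact: h2.
Qed.
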